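(* Let $g:\mathbb{R}^2\to\mathbb{R}$ be a continuous function such that: (1) $g(x,y)\ge 0$ for all $x,y\in\mathbb{R}$; (2) for every $0<\alpha\le 1$, $M_\alpha:=\iint g^\alpha(x,y)\,dx\,dy<\infty$; (3) there is a constant $C\in\mathbb{R}$ with $g(x,y)\le e^C$ for all $x,y$; (4) for every $a>0$ the set $\{(x,y): g(x,y)\ge e^{-a}\}\subset\mathbb{R}^2$ is compact; (5) there is a $\beta\ge 0$ such that $(x,y)\mapsto \beta\log|x-y|-\log g(x,y)$ extends from $\{(x,y):x\neq y\}$ to a continuous function on $\mathbb{R}^2$. Suppose in addition that $k(x,y)=-\log g(x,y)$ is a (real-valued) continuous negative definite kernel on $\mathbb{R}^2$. For each $n\ge1$ let $(x_1,\dots,x_n,y_1,\dots,y_n)$ be distributed according to the probability measure $\Pr_n$ on $\mathbb{R}^{2n}$ with density $\frac{1}{Z_n}\prod_{i,j=1}^n g(x_i,y_j)$. Then the average empirical measures $$\hat\sigma_n=\frac1{2n}\sum_{i=1}^n(\delta_{x_i}+\delta_{y_i})$$ satisfy the large deviation principle in the scale $n^2$ with the rate function $$\mathbb{I}(\nu)=\iint k(x,y)\,\nu(dx)\,\nu(dy)-I_0,\qquad \nu\in\mathcal{P}(\mathbb{R}),$$ where $I_0=\inf_{x,y\in\mathbb{R}}k(x,y)$, and moreover $I_0=\inf_{x\in\mathbb{R}}k(x,x)$.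
   Context: A kernel $k:\mathbb{R}^2\to\mathbb{R}$ is negative definite if $k(x,y)=k(y,x)$ and $\sum_{i,j} k(x_i,x_j)c_ic_j\le0$ for all finite families $x_i,c_i\in\mathbb{R}$ with $\sum_i c_i=0$. $\mathcal{P}(\mathbb{R})$ is the Polish space of Borel probability measures on $\mathbb{R}$ with the topology of weak convergence. $Z_n=\int_{\mathbb{R}^{2n}}\prod_{i,j=1}^n g(x_i,y_j)\,dx_1\cdots dx_n\,dy_1\cdots dy_n$ is the normalizing constant. Since $k$ is bounded from below, the double integral is well defined in $(-\infty,\infty]$. A sequence of random elements $\xi_n$ of a Polish space $E$ satisfies the large deviation principle in the scale $n^2$ with rate function $I:E\to[0,\infty]$ if $I$ is lower semicontinuous, $\limsup_{n}\frac1{n^2}\log\Pr(\xi_n\in F)\le-\inf_F I$ for every closed $F\subset E$, and $\liminf_n\frac1{n^2}\log\Pr(\xi_n\in G)\ge-\inf_G I$ for every open $G\subset E$. *)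

(* Defs.v *)
From HB Require Import structures.
From mathcomp Require Import all_boot all_order all_algebra.
From mathcomp Require Import all_classical all_reals all_analysis.

Set Implicit Arguments.
Unset Strict Implicit.
Unset Printing Implicit Defensive.
Import Order.TTheory GRing.Theory Num.Theory.
Import numFieldNormedType.Exports.
Local Open Scope classical_set_scope.
Local Open Scope ring_scope.

(* The Borel sigma-algebra of R^n is the canonical (product) one on
   n.-tuple (measurableTypeR R), where measurableTypeR R is R with its Borel
   sets.  Lebesgue measure on R^n.+1 is the image of the product of the Lebesgue
   measures on R and R^n under (x, v) |-> x :: v, and on R^0 the unit mass at
   the empty tuple. *)
Section LebesgueTuple.
Context (R : realType).
Local Notation T := (measurableTypeR R).

Section step.
Context (n : nat) (mu : {sigma_finite_measure set (n.-tuple T) -> \bar R}).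

Definition tuple_of_pair (p : T * n.-tuple T) : n.+1.-tuple T :=
  [tuple of p.1 :: p.2].

Definition lebesgue_tupleS : set (n.+1.-tuple T) -> \bar R :=
  pushforward (lebesgue_measure \x mu)%E tuple_of_pair.

Lemma measurable_tuple_of_pair :
  measurable_fun [set: T * n.-tuple T] tuple_of_pair.
Proof.
exact: (@measurable_cons _ _ (T * n.-tuple T)%type T fst n snd).
Qed.

Let lebesgue_tupleS0 : lebesgue_tupleS set0 = 0%E.
Proof. by rewrite /lebesgue_tupleS /pushforward preimage_set0 measure0. Qed.

Let lebesgue_tupleS_ge0 A : (0 <= lebesgue_tupleS A)%E.
Proof. by rewrite /lebesgue_tupleS /pushforward. Qed.

Let lebesgue_tupleS_additive : semi_sigma_additive lebesgue_tupleS.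
Proof.
have mf := measurable_tuple_of_pair.
move=> F mF tF mUF; rewrite /lebesgue_tupleS /pushforward preimage_bigcup.
apply: measure_semi_sigma_additive.
- by move=> i; rewrite -[X in measurable X]setTI; exact: mf.
- apply/trivIsetP => /= i j _ _ ij; rewrite -preimage_setI.
  by move/trivIsetP : tF => /(_ _ _ _ _ ij) ->//; rewrite preimage_set0.
- by rewrite -preimage_bigcup -[X in measurable X]setTI; exact: mf.
Qed.

HB.instance Definition _ := isMeasure.Build _ _ _ lebesgue_tupleS
  lebesgue_tupleS0 lebesgue_tupleS_ge0 lebesgue_tupleS_additive.

Let lebesgue_tupleS_sigma_finite : sigma_finite setT lebesgue_tupleS.
Proof.
have /sigma_finiteP[F [TF ndF Foo]] := sigma_finiteT (@lebesgue_measure R).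
have /sigma_finiteP[G [TG ndG Goo]] := sigma_finiteT mu.
pose u (t : n.+1.-tuple T) : T * n.-tuple T := (thead t, [tuple of behead t]).
have mu_u : measurable_fun setT u.
  by apply: measurable_fun_pair; [exact: measurable_tnth|exact: measurable_behead].
have uK p : u (tuple_of_pair p) = p.
  by case: p => x v; rewrite /u; congr pair; exact/val_inj.
exists (fun k => u @^-1` (F k `*` G k)) => [|k].
  rewrite -preimage_bigcup -(preimage_setT u); congr (_ @^-1` _).
  rewrite -setXTT TF TG predeqE => -[x y]; split.
    move=> [/= [i _ Fix] [k _ Gky]]; exists (maxn i k) => //; split.
    - by move: x Fix; exact/subsetPset/ndF/leq_maxl.
    - by move: y Gky; exact/subsetPset/ndG/leq_maxr.
  by move=> [i _ []/= ? ?]; split; exists i.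
have [? ?] := Foo k; have [? ?] := Goo k; split.
  by rewrite -[X in measurable X]setTI; apply: mu_u => //; exact: measurableX.
rewrite /lebesgue_tupleS /pushforward -comp_preimage (_ : u \o _ = id).
  by rewrite preimage_id product_measure1E// lte_mul_pinfty// ge0_fin_numE.
by apply/funext => p; exact: uK.
Qed.

HB.instance Definition _ := Measure_isSigmaFinite.Build _ _ _ lebesgue_tupleS
  lebesgue_tupleS_sigma_finite.

End step.

Fixpoint lebesgue_tuple (n : nat) :
    {sigma_finite_measure set (n.-tuple T) -> \bar R} :=
  match n with
  | 0 => (\d_[tuple] : {sigma_finite_measure set (0.-tuple T) -> \bar R})
  | n'.+1 => lebesgue_tupleS (lebesgue_tuple n')
  end.

End LebesgueTuple.

(* P(R) with the weak topology: the coarsest one making P |-> \int f dP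
   continuous for every bounded continuous f. *)
Section WeakTopology.
Context (R : realType).

Definition bounded_continuous : Type :=
  {f : R -> R | continuous f /\ bounded_fun f}.

Definition integrals (P : probability (measurableTypeR R) R) :
    {ptws bounded_continuous -> R} :=
  fun f => \int[P]_x (sval f x).

Definition borel_probability := initial_topology integrals.

HB.instance Definition _ := Topological.on borel_probability.

End WeakTopology.

Section LargeDeviations.
Local Open Scope ereal_scope.
Context (R : realType).

(* The measurability clause says that the xi_ n are random elements of E for the
   Borel sigma-algebra of E. *)
Definition large_deviation_principle (d : nat -> measure_display)
    (Omega : forall n, measurableType (d n))
    (P : forall n, probability (Omega n) R)
    (E : topologicalType) (xi : forall n, Omega n -> E)
    (speed : nat -> R) (I : E -> \bar R) : Prop :=
  [/\ forall n (G : set E), open G -> measurable (xi n @^-1` G),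
      (forall x, 0 <= I x) /\ lower_semicontinuous I,
      forall F : set E, closed F ->
        limn_esup (fun n => (speed n)^-1%:E * lne (P n (xi n @^-1` F)))
          <= - ereal_inf (I @` F) &
      forall G : set E, open G ->
        - ereal_inf (I @` G)
          <= limn_einf (fun n => (speed n)^-1%:E * lne (P n (xi n @^-1` G)))].

End LargeDeviations.

Definition negative_definite (R : realType) (k : R * R -> R) : Prop :=
  (forall x y, k (x, y) = k (y, x)) /\
  forall (m : nat) (x c : 'I_m -> R), \sum_i c i = 0 ->
    \sum_i \sum_j k (x i, x j) * c i * c j <= 0.

Section TwoSpecies.
Context (R : realType).
Local Notation T := (measurableTypeR R).

(* A configuration (x_1, ..., x_n, y_1, ..., y_n) in R^(2n) is encoded as the
   pair (x, y) of n-tuples. *)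
Section gibbs.
Context (g : R * R -> R) (n : nat).

Definition gibbs_weight (z : n.-tuple T * n.-tuple T) : R :=
  \prod_(i < n) \prod_(j < n) g (tnth z.1 i, tnth z.2 j).

Definition partition_function : \bar R :=
  (\int[lebesgue_tuple R n \x lebesgue_tuple R n]_z (gibbs_weight z)%:E)%E.

(* A set function only: it is a probability measure when g is nonnegative and
   measurable and 0 < partition_function < +oo. *)
Definition gibbs (A : set (n.-tuple T * n.-tuple T)) : \bar R :=
  (\int[lebesgue_tuple R n \x lebesgue_tuple R n]_(z in A)
     (gibbs_weight z / fine partition_function)%:E)%E.

End gibbs.

(* Configurations of 2(n+1) points: for no points the formula is not a
   probability measure. *)
Section empirical.
Context (n : nat) (z : n.+1.-tuple T * n.+1.-tuple T).

Definition average_empirical (A : set T) : \bar R :=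
  (((2 * n.+1)%:R^-1)%:E *
   \sum_(i < n.+1) (\d_(tnth z.1 i) A + \d_(tnth z.2 i) A))%E.

Let average_empirical0 : average_empirical set0 = 0%E.
Proof.
by rewrite /average_empirical big1 ?mule0// => i _; rewrite !measure0 adde0.
Qed.

Let average_empirical_ge0 A : (0 <= average_empirical A)%E.
Proof.
apply: mule_ge0; first by rewrite lee_fin invr_ge0.
by apply: sume_ge0 => i _; exact: adde_ge0.
Qed.

Let average_empirical_additive : semi_sigma_additive average_empirical.
Proof.
have c0 : 0 <= (2 * n.+1)%:R^-1 :> R by rewrite invr_ge0.
pose a k : {measure set T -> \bar R} := \d_(nth 0 z.1 k : T).
pose b k : {measure set T -> \bar R} := \d_(nth 0 z.2 k : T).
pose m := mscale (NngNum c0)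
  (msum (fun k => msum (fun j => if j is 0 then a k else b k) 2) n.+1).
suff -> : average_empirical = m by exact: measure_semi_sigma_additive.
apply/funext => A; rewrite /average_empirical /m /mscale /=; congr (_ * _)%E.
apply: eq_bigr => i _.
by rewrite !(tnth_nth 0); exact/esym/(measure_addE (a i) (b i)).
Qed.

HB.instance Definition _ := isMeasure.Build _ _ _ average_empirical
  average_empirical0 average_empirical_ge0 average_empirical_additive.

Let average_empiricalT : average_empirical setT = 1%E.
Proof.
rewrite /average_empirical (eq_bigr (fun=> 2%:E)) => [|i _]; last first.
  by rewrite !diracT -EFinD.
rewrite sumEFin sumr_const card_ord -EFinM -mulrnA mulVf// pnatr_eq0.
Qed.

HB.instance Definition _ := Measure_isProbability.Build _ _ _ average_empirical
  average_empiricalT.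

Definition average_empirical_measure : borel_probability R :=
  (average_empirical : probability T R).

End empirical.

Definition energy (k : R * R -> R) (nu : borel_probability R) : \bar R :=
  let nu' : probability T R := nu in
  (\int[nu' \x nu']_z (k z)%:E)%E.

End TwoSpecies.

(* Main.v *)
Require Import Defs.
From HB Require Import structures.
From mathcomp Require Import all_boot all_order all_algebra.
From mathcomp Require Import all_classical all_reals all_analysis.
From mathcomp Require Import measurable_realfun.
From mathcomp Require Import zify ring lra.
Import Order.TTheory GRing.Theory Num.Theory.
Import numFieldNormedType.Exports.
Local Open Scope classical_set_scope.
Local Open Scope ring_scope.
Set Implicit Arguments.
Unset Strict Implicit.
Unset Printing Implicit Defensive.

(** Write N for the number of points of each species, S for the sum of the
    k (x_i, y_j), so that the Gibbs weight is exp(- S), k0 for the infimum of k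
    and E (nu) for the double integral of k against nu.

    Negative definiteness enters through two inequalities. With coefficients
    +1 at one point and -1 at another it gives k (x, x) + k (y, y) <= 2 k (x, y)
    ([negdef2]), so the infimum of k is that of its diagonal. With +1 on all
    x_i and -1 on all y_j it gives N^2 E (sigma) <= S, where sigma is the average
    empirical measure ([energy_average_le]); equality holds when
    the x_i and the y_i are the same points.

    Upper bound. If sigma lies in F then S >= N^2 inf_F E. The weight is at most
    exp(- (1 - e) N^2 inf_F E) times its own power e, and the integral of the
    latter is at most exp(- e N^2 k0) up to a factor exponential in N, because its
    off-diagonal factors are bounded and its diagonal ones are integrated
    independently ([boltzmann_upper], [integral_diag_prod]). Divide by the
    partition function and let e tend to 0.

    Lower bound. Let nu in the open set G have finite energy. Averaging over
    samples from nu yields finitely many points whose uniform measure still lies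
    in G and has energy at most E (nu) + e ([energy_approximation]). Repeat these
    points cyclically N times, and integrate the weight over the configurations in
    which every x_i and y_i is within 1/N of the i-th of them: there sigma is in G,
    S is at most N^2 (E (nu) + e), and the volume (2/N)^(2N) is negligible in the
    scale N^2 ([boltzmann_lower_eventually]). For nu a point mass this also bounds
    the partition function from below by exp(- N^2 (k0 + e)).

    The rate function is lower semicontinuous because a continuous kernel bounded
    below is approached from below by finite sums of products of bounded
    continuous functions ([energy_lower_semicontinuous]). *)

(** * The weak topology *)

Lemma weak_cvg (R : realType) (F : set_system (borel_probability R))
    {FF : Filter F} (nu : borel_probability R) :
  (forall f : bounded_continuous R,
    (fun P : borel_probability R => integrals P f) @ F --> integrals nu f) ->
  F --> nu.
Proof.
move=> cvF A; rewrite nbhsE => -[_ [[V oV <-] Vnu] sVA].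
rewrite nbhs_filterE; apply: filterS sVA _.
have : (fun P : borel_probability R => integrals P) @ F -->
    (integrals nu : {ptws bounded_continuous R -> R}).
  apply/cvg_sup => f B; rewrite nbhsE => -[_ [[U oU <-] Uf] sUB].
  rewrite nbhs_filterE; apply: filterS sUB _.
  by apply: (cvF f); apply: open_nbhs_nbhs; split.
by apply; apply: open_nbhs_nbhs; split.
Qed.

Lemma weak_continuous (R : realType) (f : bounded_continuous R) :
  continuous (fun P : borel_probability R => integrals P f).
Proof.
move=> P.
have h := @initial_continuous _ _
  (@integrals R : borel_probability R -> {ptws bounded_continuous R -> R}) P.
pose i0 : {ptws bounded_continuous R -> R} := integrals P.
have /cvg_sup/(_ f) h2 : nbhs i0 --> i0 by apply: cvg_id.
move=> B /(@initial_continuous _ R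
  (fun g : bounded_continuous R -> R => g f) i0) /h2.
exact: h.
Qed.

(** The finite families of test functions are extracted from the abstract
    topology by the filter F that they generate: F converges to nu by
    [weak_cvg], hence contains every neighbourhood of nu. *)
Lemma weak_open_nbhs (R : realType) (G : set (borel_probability R))
    (nu : borel_probability R) : open G -> G nu ->
  exists (fs : seq (bounded_continuous R)) (eta : R), 0 < eta /\
    forall rho : borel_probability R,
      (forall f, List.In f fs -> `|integrals rho f - integrals nu f| < eta) -> G rho.
Proof.
move=> oG Gnu.
pose F : set_system (borel_probability R) := [set A |
  exists (fs : seq (bounded_continuous R)) (eta : R), 0 < eta /\
    forall rho : borel_probability R,
      (forall f, List.In f fs -> `|integrals rho f - integrals nu f| < eta) -> A rho].
have FF : Filter F.
  split; first by exists [::], 1.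
  - move=> P Q [fs [e [e0 eP]]] [gs [d [d0 dQ]]].
    exists (fs ++ gs), (Num.min e d); split; first by rewrite lt_min e0.
    move=> rho H; split; [apply: eP|apply: dQ] => f fin.
      have /H : List.In f (fs ++ gs) by apply: List.in_or_app; left.
      by rewrite lt_min => /andP[].
    have /H : List.In f (fs ++ gs) by apply: List.in_or_app; right.
    by rewrite lt_min => /andP[].
  - by move=> P Q PQ [fs [e [e0 eP]]]; exists fs, e; split=> // rho /eP /PQ.
have : F --> nu.
  apply: weak_cvg => f; apply/cvgrPdist_lt => e e0.
  by exists [:: f], e; split=> // rho H; rewrite distrC; apply: H; left.
by move=> /(_ G); apply; apply: open_nbhs_nbhs; split.
Qed.

(** * Measurability through countable bases of rational boxes *)

(** The form in which second countability is used: the product sigma-algebras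
    below are generated by the coordinates, and an open set belongs to them because
    it is covered by boxes with rational centres and radii 1/(m+1) inside it. *)
Lemma measurable_countable_cover d (X : measurableType d) (I : countType)
    (C : I -> set X) (A : set X) :
  (forall i, measurable (C i)) ->
  (forall z, A z -> exists2 i, C i z & C i `<=` A) -> measurable A.
Proof.
move=> mC AC.
have -> : A = \bigcup_i (if `[< C i `<=` A >] then C i else set0).
  apply/seteqP; split=> [z /AC[i Ciz CiA]|z [i _]].
    by exists i => //; case: asboolP.
  by case: asboolP => // /[apply].
apply: countable_bigcupT_measurable => [|i]; last by case: ifP.
exact: countableP.
Qed.

Lemma ratr_approx (R : realType) (x e : R) : 0 < e ->
  exists q : rat, `|x - ratr q| < e.
Proof.
move=> e0; have [|q] := @rat_in_itvoo R (x - e) (x + e); first by lra.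
by rewrite in_itv/= => /andP[h1 h2]; exists q; rewrite ltr_norml; lra.
Qed.

Lemma measurable_near_cst d (X : measurableType d) (R : realType)
    (f : X -> measurableTypeR R) (c e : R) :
  measurable_fun setT f -> measurable [set z | `|f z - c| < e].
Proof.
move=> mf.
have -> : [set z | `|f z - c| < e] = setT `&` f @^-1` `]c - e, c + e[%classic.
  by rewrite setTI; apply/seteqP; split => z /=; rewrite in_itv/= ltr_norml; lra.
exact: mf.
Qed.

Lemma near_trans (R : realType) (a b c e : R) :
  `|a - c| < e / 2 -> `|b - c| < e / 2 -> `|a - b| < e.
Proof. by rewrite !ltr_norml; lra. Qed.

Lemma measurable_continuous2 (R : realType) (k : R * R -> R) :
  continuous k ->
  measurable_fun [set: (measurableTypeR R * measurableTypeR R)%type] k.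
Proof.
move=> ck; apply: (measurability _ (RGenOpens.measurableE R)).
move=> _ [_ [a [b ->]] <-].
rewrite setTI.
pose cell (u : rat * rat * nat) : set (measurableTypeR R * measurableTypeR R) :=
  [set z | `|z.1 - ratr u.1.1| < u.2.+1%:R^-1] `&`
  [set z | `|z.2 - ratr u.1.2| < u.2.+1%:R^-1].
apply: (@measurable_countable_cover _ _ _ cell) => [u|[x y] kz].
  by apply: measurableI; exact: measurable_near_cst.
have : nbhs (x, y) (k @^-1` `]a, b[).
  by apply: ck; apply: open_nbhs_nbhs; split; [exact: interval_open|exact: kz].
move=> /nbhs_ballP[r /= r0 sub].
have [m] := @ltr_add_invr R 0 (r / 2) ltac:(lra); rewrite add0r => mr.
have [p xp] := @ratr_approx R x m.+1%:R^-1 ltac:(by rewrite invr_gt0).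
have [q yq] := @ratr_approx R y m.+1%:R^-1 ltac:(by rewrite invr_gt0).
exists (p, q, m) => [|[x' y'] [/= x'p y'q]]; first by split.
apply: sub; split; rewrite /ball/=; apply: near_trans;
  apply: lt_trans mr; [exact: xp|exact: x'p|exact: yq|exact: y'q].
Qed.

Definition close {R : realType} {n : nat} (r : R) (z z' : n.-tuple R * n.-tuple R) :=
  forall i, `|tnth z'.1 i - tnth z.1 i| < r /\ `|tnth z'.2 i - tnth z.2 i| < r.

Lemma tuple_choice (n : nat) (T : Type) (P : 'I_n -> T -> Prop) :
  (forall i, exists x, P i x) -> exists t : n.-tuple T, forall i, P i (tnth t i).
Proof.
move=> /choice[f Pf]; exists [tuple f i | i < n] => i.
by rewrite tnth_mktuple.
Qed.

Lemma measurable_close_open (R : realType) (n : nat)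
    (A : set (n.-tuple (measurableTypeR R) * n.-tuple (measurableTypeR R))) :
  (forall z, A z -> exists2 r : R, 0 < r & close r z `<=` A) -> measurable A.
Proof.
move=> oA.
pose cell (u : n.-tuple rat * n.-tuple rat * nat) :
    set (n.-tuple (measurableTypeR R) * n.-tuple (measurableTypeR R)) :=
  \bigcap_(i in [set: 'I_n])
   ([set z | `|(@tnth _ (measurableTypeR R) ^~ i \o fst) z
               - ratr (tnth u.1.1 i)| < u.2.+1%:R^-1] `&`
    [set z | `|(@tnth _ (measurableTypeR R) ^~ i \o snd) z
               - ratr (tnth u.1.2 i)| < u.2.+1%:R^-1]).
apply: (@measurable_countable_cover _ _ _ cell) => [u|z Az].
  apply: fin_bigcap_measurable => // i _.
  by apply: measurableI; apply: measurable_near_cst; apply: measurableT_comp => //;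
    exact: measurable_tnth.
have [r r0 sub] := oA z Az.
have [m] := @ltr_add_invr R 0 (r / 2) ltac:(lra); rewrite add0r => mr.
have m0 : 0 < m.+1%:R^-1 :> R by rewrite invr_gt0.
have [p zp] := @tuple_choice _ _ _ (fun i => @ratr_approx R (tnth z.1 i) m.+1%:R^-1 m0).
have [q zq] := @tuple_choice _ _ _ (fun i => @ratr_approx R (tnth z.2 i) m.+1%:R^-1 m0).
exists (p, q, m) => [i _|z' z'C]; first by split; [exact: zp|exact: zq].
apply: sub => i; have [h1 h2] := z'C i I; split;
  apply: near_trans; apply: lt_trans mr; [exact: h1|exact: zp|exact: h2|exact: zq].
Qed.

(** * Integrals and energy of an average empirical measure *)

Section sample_mean.
Context (R : realType) (n : nat).
Local Notation T := (measurableTypeR R).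
Implicit Types (z : n.+1.-tuple T * n.+1.-tuple T) (f : T -> R).

Definition sample_mean z f : R :=
  (2 * n.+1)%:R^-1 * \sum_(i < n.+1) (f (tnth z.1 i) + f (tnth z.2 i)).

Lemma ge0_integral_average z f : measurable_fun [set: T] f ->
  (forall x, 0 <= f x) ->
  (\int[average_empirical z]_x (f x)%:E = (sample_mean z f)%:E)%E.
Proof.
move=> mf f0; have c0 : 0 <= (2 * n.+1)%:R^-1 :> R by rewrite invr_ge0.
have mf' : measurable_fun [set: T] (fun x : T => (f x)%:E) by exact/measurable_EFinP.
pose a k : {measure set T -> \bar R} := \d_(nth 0 z.1 k : T).
pose b k : {measure set T -> \bar R} := \d_(nth 0 z.2 k : T).
pose s : nat -> {measure set T -> \bar R} :=
  fun k => msum (fun j => if j is 0 then a k else b k) 2.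
transitivity (\int[mscale (NngNum c0) (msum s n.+1)]_x (f x)%:E)%E.
  congr (integral _ _ _); apply/funext => A; rewrite /average_empirical /mscale /=.
  congr (_ * _)%E; apply: eq_bigr => i _.
  by rewrite !(tnth_nth 0); exact/esym/(measure_addE (a i) (b i)).
rewrite ge0_integral_mscale//; last by move=> x _; rewrite lee_fin.
rewrite ge0_integral_measure_sum//; last by move=> x _; rewrite lee_fin.
rewrite /sample_mean EFinM -sumEFin; congr (_ * _)%E; apply: eq_bigr => i _.
rewrite ge0_integral_measure_sum//; last by move=> x _; rewrite lee_fin.
rewrite !big_ord_recl big_ord0 adde0 /= /a /b !integral_dirac// !diracT !mul1e.
by rewrite !(tnth_nth 0).
Qed.

Lemma sample_meanB z f h : sample_mean z (f \- h) = sample_mean z f - sample_mean z h.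
Proof.
rewrite /sample_mean -mulrBr -sumrB; congr (_ * _); apply: eq_bigr => i _ /=.
by rewrite opprD addrACA.
Qed.

Lemma integral_average z f : measurable_fun [set: T] f ->
  (\int[average_empirical z]_x (f x)%:E = (sample_mean z f)%:E)%E.
Proof.
move=> mf; rewrite integralE -[fun x => (f x)%:E]/(EFin \o f) funerpos funerneg.
rewrite /comp !ge0_integral_average//.
- rewrite -EFinB -sample_meanB; congr (sample_mean _ _)%:E.
  exact: funrposBneg.
- exact: measurable_funrneg.
- exact: measurable_funrpos.
Qed.
End sample_mean.

Section energy_average.
Context (R : realType) (n : nat).
Local Notation T := (measurableTypeR R).

Lemma measurable_sample_mean d (X : measurableType d)
   (z : n.+1.-tuple T * n.+1.-tuple T) (F : X -> T -> R) :
  (forall y, measurable_fun [set: X] (F ^~ y)) ->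
  measurable_fun [set: X] (fun x => sample_mean z (F x)).
Proof.
move=> mF; rewrite /sample_mean; apply: measurable_funM => //.
by apply: measurable_sum => i; exact: measurable_funD.
Qed.

(** Only finitely many points carry mass, so k is integrable whatever its growth
    and the double integral is an iterated finite sum. *)
Lemma energy_average (k : R * R -> R) (z : n.+1.-tuple T * n.+1.-tuple T) :
  continuous k ->
  energy k (average_empirical_measure z) =
  (sample_mean z (fun x => sample_mean z (fun y => k (x, y))))%:E.
Proof.
move=> /measurable_continuous2 mk.
have mk1 x : measurable_fun [set: T] (fun y : T => k (x, y)).
  by apply: measurableT_comp => //; exact: pair1_measurable.
have mk2 y : measurable_fun [set: T] (fun x : T => k (x, y)).
  by apply: measurableT_comp => //; exact: pair2_measurable.
have mEk : measurable_fun setT (fun z : T * T => (k z)%:E).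
  exact/measurable_EFinP.
rewrite /energy /=.
pose sigma : probability T R := average_empirical z.
have ik : (sigma \x sigma)%E.-integrable setT (fun z : T * T => (k z)%:E).
  apply/integrable12ltyP => //.
  under eq_integral => x _.
    under eq_integral do rewrite abse_EFin.
    rewrite integral_average; last by apply: measurableT_comp => //; exact: mk1.
    over.
  rewrite integral_average ?ltry//.
  by apply: measurable_sample_mean => y; apply: measurableT_comp => //; exact: mk2.
rewrite -integral12_prod_meas1//=.
rewrite /fubini_F; under eq_integral do rewrite integral_average//.
by rewrite integral_average//; exact: measurable_sample_mean.
Qed.
End energy_average.

(** * Lebesgue measure on tuples *)

Section tuple_integrals.
Context (R : realType).
Local Notation T := (measurableTypeR R).

Lemma ge0_integral_tupleS (n : nat) (F : n.+1.-tuple T -> \bar R) :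
  measurable_fun setT F -> (forall v, 0 <= F v)%E ->
  (\int[lebesgue_tuple R n.+1]_v F v =
   \int[@lebesgue_measure R]_x \int[lebesgue_tuple R n]_v F [tuple of x :: v])%E.
Proof.
move=> mF F0.
rewrite [LHS](ge0_integral_pushforward (@measurable_tuple_of_pair R n))//.
rewrite preimage_setT (fubini_tonelli1 (F \o @tuple_of_pair R n))//.
  exact: (measurableT_comp mF (@measurable_tuple_of_pair R n)).
by move=> ?; exact: F0.
Qed.

(** The centre is a sequence rather than a tuple, so that one centre serves cubes
    of every dimension and the induction on the dimension shifts it. *)
Definition cube (n : nat) (a : nat -> R) (r : R) : set (n.-tuple T) :=
  [set v | forall i, `|tnth v i - a i| < r].

Lemma measurable_cube n a r : measurable (@cube n a r).
Proof.
have -> : @cube n a r = \bigcap_(i in [set: 'I_n])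
    [set v | `|(@tnth _ T ^~ i) v - a i| < r].
  by apply/seteqP; split=> v h i; [move=> _|]; exact: h.
apply: fin_bigcap_measurable => // i _.
by apply: measurable_near_cst; exact: measurable_tnth.
Qed.

Lemma lebesgue_cube n a r : 0 < r ->
  (lebesgue_tuple R n (@cube n a r) = ((2 * r) ^+ n)%:E)%E.
Proof.
move=> r0; elim: n a => [|n IH] a /=.
  by rewrite diracE mem_set//; case.
rewrite /lebesgue_tupleS /pushforward.
have -> : (@tuple_of_pair R n) @^-1` (@cube n.+1 a r) =
    ball (a 0%N) r `*` @cube n (fun i => a i.+1) r.
  apply/seteqP; split=> -[x v]/=.
    move=> h; split.
      by have := h ord0; rewrite /ball/= distrC.
    by move=> i; have := h (lift ord0 i); rewrite /tuple_of_pair/= tnthS.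
  move=> [xa h] i.
  have [j ->|->] := unliftP ord0 i.
    by rewrite /tuple_of_pair/= tnthS; exact: h.
  by rewrite /tuple_of_pair/= tnth0 distrC.
rewrite product_measure1E//; first last.
- exact: measurable_cube.
- exact: measurable_ball.
rewrite [X in (X * _)%E](lebesgue_measure_ball (a 0%N) (ltW r0)).
by rewrite (IH (fun i => a i.+1)) -EFinM exprS mulr_natl.
Qed.

Lemma measurable_diag_prod (n : nat) (G : T * T -> R) :
  measurable_fun setT G ->
  measurable_fun setT (fun z : n.-tuple T * n.-tuple T =>
    \prod_(i < n) G (tnth z.1 i, tnth z.2 i)).
Proof.
move=> mG; apply: measurable_prod => i _.
apply: measurableT_comp => //; apply: measurable_fun_pair;
  by apply: (measurableT_comp (@measurable_tnth _ T n i)).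
Qed.

(** Each pair (x_i, y_i) occurs in one factor only: Tonelli splits the integral
    over R^(2n) into n independent integrals over R^2. This is what makes a
    small power of the Gibbs weight contribute a factor that is exponential in n,
    not in n^2. *)
Lemma integral_diag_prod (n : nat) (G : T * T -> R) :
  measurable_fun setT G -> (forall z, 0 <= G z) ->
  (\int[lebesgue_tuple R n \x lebesgue_tuple R n]_z
     (\prod_(i < n) G (tnth z.1 i, tnth z.2 i))%:E =
   (\int[@lebesgue_measure R \x @lebesgue_measure R]_z (G z)%:E) ^+ n)%E.
Proof.
move=> mG G0.
pose P n (z : n.-tuple T * n.-tuple T) : \bar R :=
  (\prod_(i < n) G (tnth z.1 i, tnth z.2 i))%:E.
have mP m : measurable_fun setT (P m).
  by apply/measurable_EFinP; exact: measurable_diag_prod.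
have P0 m z : (0 <= P m z)%E by rewrite lee_fin prodr_ge0.
have mEG : measurable_fun setT (fun z : T * T => (G z)%:E).
  exact/measurable_EFinP.
have EG0 z : (0 <= (G z)%:E)%E by rewrite lee_fin.
have mP1 m x : measurable_fun setT (fun y => P m (x, y)).
  by apply: (measurableT_comp (mP m)); exact: pair1_measurable.
have mG1 x : measurable_fun setT (fun y : T => (G (x, y))%:E).
  by apply: (measurableT_comp mEG); exact: pair1_measurable.
have mPF m := @measurable_fun_fubini_tonelli_F _ _ _ _ R (lebesgue_tuple R m) (P m) (mP m) (P0 m).
have mGF := @measurable_fun_fubini_tonelli_F _ _ _ _ R (@lebesgue_measure R) _ mEG EG0.
rewrite -[LHS]/(\int[lebesgue_tuple R n \x lebesgue_tuple R n]_z (P n z))%E.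
rewrite (fubini_tonelli1 _ (mP n) (P0 n)) (fubini_tonelli1 _ mEG EG0).
elim: n => [|n IH].
  rewrite expe0 /fubini_F /= !integral_dirac//; last exact: (mP1 0%N).
  rewrite /= /dirac !indicE !in_setT !mul1e.
  by rewrite /P big_ord0.
rewrite ge0_integral_tupleS; [|exact: mPF|].
  2: by move=> v; apply: integral_ge0 => y _; exact: P0.
have inner (x : T) (v : n.-tuple T) :
   (fubini_F (lebesgue_tuple R n.+1) (P n.+1) ([tuple of x :: v] : n.+1.-tuple T) =
    fubini_F (@lebesgue_measure R) (fun z : T * T => (G z)%:E) x *
    fubini_F (lebesgue_tuple R n) (P n) v)%E.
  rewrite [LHS]ge0_integral_tupleS; [|exact: mP1|by move=> w; exact: P0].
  rewrite /fubini_F -(ge0_integralZr _ measurableT (mG1 x)); last 2 first.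
  - by move=> y _; exact: EG0.
  - by apply: integral_ge0 => y _; exact: P0.
  apply: eq_integral => y _; rewrite -(ge0_integralZl _ measurableT (mP1 n v))//.
  apply: eq_integral => w _; rewrite /P big_ord_recl /= !tnth0 EFinM.
  congr (_ * _%:E)%E; apply: eq_bigr => i _.
  by rewrite !tnthS.
rewrite expeS -IH -(ge0_integralZr _ measurableT mGF); last 2 first.
- by move=> x _; apply: integral_ge0 => y _; exact: EG0.
- by apply: integral_ge0 => v _; apply: integral_ge0 => y _; exact: P0.
apply: eq_integral => x _; under eq_integral do rewrite inner.
rewrite (ge0_integralZl _ measurableT (mPF n))//.
- by move=> v _; apply: integral_ge0 => y _; exact: P0.
- by apply: integral_ge0 => y _; exact: EG0.
Qed.
End tuple_integrals.

(** * The interaction of two species and bounds on Gibbs integrals *)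

Section interaction.
Context (R : realType).
Local Notation T := (measurableTypeR R).
Variable k : R * R -> R.

Definition interaction (n : nat) (z : n.-tuple T * n.-tuple T) : R :=
  \sum_(i < n) \sum_(j < n) k (tnth z.1 i, tnth z.2 j).

Lemma gibbs_weight_expR (g : R * R -> R) n (z : n.-tuple T * n.-tuple T) :
  (forall u, g u = expR (- k u)) -> gibbs_weight g z = expR (- interaction z).
Proof.
move=> gE; rewrite /gibbs_weight /interaction -sumrN expR_sum; apply: eq_bigr => i _.
by rewrite -sumrN expR_sum; apply: eq_bigr => j _; rewrite gE.
Qed.

Lemma measurable_interaction n : continuous k ->
  measurable_fun setT (@interaction n).
Proof.
move=> /measurable_continuous2 mk.
apply: measurable_sum => i; apply: measurable_sum => j.
apply: (measurableT_comp mk); apply: measurable_fun_pair.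
  exact: (measurableT_comp (@measurable_tnth _ T n i)).
exact: (measurableT_comp (@measurable_tnth _ T n j)).
Qed.

(** Negative definiteness with the coefficients +1 on the points x_i and -1 on
    the points y_j. *)
Lemma interaction_polarization n (z : n.-tuple T * n.-tuple T) :
  negative_definite k ->
  \sum_(i < n) \sum_(j < n) k (tnth z.1 i, tnth z.1 j) +
  \sum_(i < n) \sum_(j < n) k (tnth z.2 i, tnth z.2 j) <= 2 * interaction z.
Proof.
move=> [ksym knd].
pose p (u : 'I_(n + n)) : R * R :=
  match fintype.split u with inl i => (tnth z.1 i, 1) | inr i => (tnth z.2 i, -1) end.
have pl i : p (lshift n i) = (tnth z.1 i, 1) by rewrite /p (unsplitK (inl i)).
have pr i : p (rshift n i) = (tnth z.2 i, -1) by rewrite /p (unsplitK (inr i)).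
have := @knd _ (fun u => (p u).1) (fun u => (p u).2).
have sumE (F : R -> R -> R) : \sum_u F (p u).1 (p u).2 =
    \sum_(i < n) F (tnth z.1 i) 1 + \sum_(i < n) F (tnth z.2 i) (-1).
  by rewrite big_split_ord; congr (_ + _); apply: eq_bigr => i _; rewrite (pl, pr).
rewrite (sumE (fun _ c => c)) -big_split/= big1 => [/(_ erefl)|i _]; last by rewrite subrr.
rewrite (sumE (fun x c => \sum_j k (x, (p j).1) * c * (p j).2)) /=.
have inner x c : \sum_j k (x, (p j).1) * c * (p j).2 =
    c * (\sum_j k (x, tnth z.1 j) - \sum_j k (x, tnth z.2 j)).
  rewrite (sumE (fun y d => k (x, y) * c * d)) mulrBr !mulr_sumr -sumrN.
  by congr (_ + _); apply: eq_bigr => j _; ring.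
under eq_bigr do rewrite inner mul1r.
under [X in _ + X]eq_bigr do rewrite inner mulN1r opprB.
rewrite !sumrB.
rewrite [X in _ + (_ - X)](_ : _ = interaction z); last first.
  rewrite exchange_big; apply: eq_bigr => i _; apply: eq_bigr => j _.
  exact: ksym.
rewrite -/(interaction z); lra.
Qed.

(** The quadratic energy of the average (mu + nu)/2 never exceeds the mutual
    energy of mu and nu: by polarization the two self-interactions are
    dominated by the cross term. Equality holds when x and y are the same points. *)
Lemma energy_average_le n (z : n.+1.-tuple T * n.+1.-tuple T) :
  continuous k -> negative_definite k ->
  (energy k (average_empirical_measure z) <=
   (interaction z / n.+1%:R ^+ 2)%:E)%E.
Proof.
move=> ck knd; have [ksym _] := knd; rewrite energy_average// lee_fin.
have := interaction_polarization z knd.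
set A := \sum_(i < _) _; set B := (X in _ + X <= _) => AB.
have E : \sum_(i < n.+1) (\sum_(j < n.+1) (k (tnth z.1 i, tnth z.1 j) + k (tnth z.1 i, tnth z.2 j))
   + \sum_(j < n.+1) (k (tnth z.2 i, tnth z.1 j) + k (tnth z.2 i, tnth z.2 j))) =
   A + B + 2 * interaction z.
  rewrite /A /B /interaction; under eq_bigr do rewrite !big_split/=.
  rewrite !big_split/=.
  rewrite [X in _ + (X + _)](_ : _ = interaction z); last first.
    rewrite exchange_big; apply: eq_bigr => i _; apply: eq_bigr => j _.
    exact: ksym.
  rewrite -/(interaction z); ring.
rewrite /sample_mean; under eq_bigr do rewrite -mulrDr.
rewrite -mulr_sumr E mulrA natrM.
rewrite -invfM ler_pdivrMl ?mulr_gt0 ?ltr0n//.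
have N0 : n.+1%:R != 0 :> R by rewrite pnatr_eq0.
rewrite (_ : _ * (_ / _) = 4 * interaction z); last by field.
lra.
Qed.

(** The n diagonal pairs are kept and the n^2 - n others are bounded by the
    lower bound k0 of k. *)
Lemma interaction_ge n (z : n.-tuple T * n.-tuple T) k0 :
  (forall u, k0 <= k u) ->
  \sum_(i < n) k (tnth z.1 i, tnth z.2 i) + (n%:R ^+ 2 - n%:R) * k0 <= interaction z.
Proof.
move=> kk0.
have -> : (n%:R ^+ 2 - n%:R) * k0 = \sum_(i < n) (\sum_(j < n) k0 - k0).
  rewrite sumrB !sumr_const card_ord -!(mulr_natl k0); ring.
rewrite -big_split /=; apply: ler_sum => i _.
rewrite (bigD1 i)//= [leRHS](bigD1 i)//=.
have : \sum_(j < n | j != i) k0 <= \sum_(j < n | j != i) k (tnth z.1 i, tnth z.2 j).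
  exact: ler_sum.
lra.
Qed.

Lemma interaction_ge_min n (z : n.-tuple T * n.-tuple T) k0 :
  (forall u, k0 <= k u) -> n%:R ^+ 2 * k0 <= interaction z.
Proof.
move=> kk0; have h := interaction_ge z kk0.
have : \sum_(i < n) k0 <= \sum_(i < n) k (tnth z.1 i, tnth z.2 i) by exact: ler_sum.
by rewrite sumr_const card_ord -mulr_natl /=; lra.
Qed.

Definition boltzmann n (z : n.-tuple T * n.-tuple T) : \bar R :=
  (expR (- interaction z))%:E.

Lemma measurable_boltzmann n : continuous k -> measurable_fun setT (@boltzmann n).
Proof.
move=> ck; apply/measurable_EFinP; apply: (measurableT_comp (@measurable_expR R)).
by apply: measurableT_comp => //; exact: measurable_interaction.
Qed.

Local Notation Leb n := (lebesgue_tuple R n \x lebesgue_tuple R n)%E.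

(** The weight is factored as its power 1 - e, bounded on A through the
    interaction, times its power e. In the latter all off-diagonal factors are
    bounded by exp(- e k0), and the diagonal ones integrate to the n-th power
    of a fixed integral over R^2. *)
Lemma boltzmann_upper n A c k0 e : continuous k -> (forall u, k0 <= k u) ->
  measurable A -> 0 <= e <= 1 ->
  (forall z, A z -> n%:R ^+ 2 * c <= interaction z) ->
  (\int[Leb n]_(z in A) boltzmann z <=
   (expR (- ((1 - e) * (n%:R ^+ 2 * c) + e * ((n%:R ^+ 2 - n%:R) * k0))))%:E *
   (\int[@lebesgue_measure R \x @lebesgue_measure R]_u (expR (- (e * k u)))%:E) ^+ n)%E.
Proof.
move=> ck kk0 mA /andP[e0 e1] Sc.
have mG : measurable_fun setT (fun u : T * T => expR (- (e * k u))).
  apply: (measurableT_comp (@measurable_expR R)); apply: measurableT_comp => //.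
  by apply: measurable_funM => //; exact: measurable_continuous2.
have G0 (u : T * T) : 0 <= expR (- (e * k u)) by exact: expR_ge0.
rewrite -integral_diag_prod//.
have mP := @measurable_diag_prod R n _ mG.
rewrite -ge0_integralZl_EFin ?expR_ge0//; last 2 first.
- by move=> z _; rewrite lee_fin prodr_ge0.
- exact/measurable_EFinP.
have mB := @measurable_boltzmann n ck.
apply: (@le_trans _ _ (\int[Leb n]_(z in A)
    ((expR (- ((1 - e) * (n%:R ^+ 2 * c) + e * ((n%:R ^+ 2 - n%:R) * k0))))%:E *
     (\prod_(i < n) expR (- (e * k (tnth z.1 i, tnth z.2 i))))%:E))%E).
  apply: ge0_le_integral => //.
  - by move=> z _; rewrite lee_fin expR_ge0.
  - exact: measurable_funTS.
  - by apply: measurable_funTS; apply/measurable_EFinP; exact: measurable_funM.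
  move=> z Az; rewrite /boltzmann -EFinM lee_fin -expR_sum -expRD ler_expR.
  have h1 := Sc z Az; have h2 := interaction_ge z kk0.
  rewrite sumrN -mulr_sumr.
  have : (1 - e) * (n%:R ^+ 2 * c) <= (1 - e) * interaction z.
    by apply: ler_wpM2l => //; rewrite subr_ge0.
  have : e * (\sum_(i < n) k (tnth z.1 i, tnth z.2 i) + (n%:R ^+ 2 - n%:R) * k0) <=
      e * interaction z.
    exact: ler_wpM2l.
  lra.
apply: ge0_subset_integral => //.
  by apply/measurable_EFinP; exact: measurable_funM.
by move=> z _; rewrite lee_fin mulr_ge0// ?expR_ge0// prodr_ge0.
Qed.

Lemma boltzmann_lower n A B a r : continuous k -> measurable A -> 0 < r ->
  (forall z, cube a r z.1 -> cube a r z.2 -> A z /\ interaction z <= B) ->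
  ((expR (- B) * ((2 * r) ^+ n * (2 * r) ^+ n))%:E <= \int[Leb n]_(z in A) boltzmann z)%E.
Proof.
move=> ck mA r0 AB.
have mC : measurable (@cube R n a r `*` @cube R n a r).
  by apply: measurableX; exact: measurable_cube.
have mB := @measurable_boltzmann n ck.
have -> : (expR (- B) * ((2 * r) ^+ n * (2 * r) ^+ n))%:E =
   (\int[Leb n]_(z in @cube R n a r `*` @cube R n a r) cst (expR (- B))%:E z)%E.
  rewrite integral_cst// EFinM; congr (_ * _)%E.
  rewrite [RHS](@product_measure1E _ _ _ _ R (lebesgue_tuple R n) (lebesgue_tuple R n));
    [|exact: measurable_cube..].
  by rewrite [X in (_ = X * _)%E](lebesgue_cube n a r0)
             [X in (_ = _ * X)%E](lebesgue_cube n a r0) EFinM.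
apply: (@le_trans _ _ (\int[Leb n]_(z in @cube R n a r `*` @cube R n a r) boltzmann z)%E).
  apply: ge0_le_integral => //.
  - by move=> z _; rewrite lee_fin expR_ge0.
  - exact: measurable_funTS.
  - by move=> -[x y] [/= xa ya]; rewrite lee_fin ler_expR lerN2; have [] := AB (x, y) xa ya.
apply: ge0_subset_integral => //.
- exact: measurable_funTS.
- by move=> z _; rewrite lee_fin expR_ge0.
- by move=> -[x y] [/= xa ya]; have [] := AB (x, y) xa ya.
Qed.
End interaction.

(** * Limits inferior and superior, and a partition of unity *)

Section limits.
Context (R : realType).
Local Open Scope ereal_scope.

Lemma limn_einf_ge (u : (\bar R)^nat) (l : \bar R) :
  (\forall n \near \oo, l <= u n) -> l <= limn_einf u.
Proof.
move=> [N _ Nu]; rewrite limn_einf_lim; apply: lime_ge; first exact: is_cvg_einfs.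
exists N => // n /= Nn; apply: le_ereal_inf_tmp => _ [m /= nm <-].
by apply: Nu; exact: leq_trans nm.
Qed.

Lemma limn_esup_le (u : (\bar R)^nat) (l : \bar R) :
  (\forall n \near \oo, u n <= l) -> limn_esup u <= l.
Proof.
move=> ul; rewrite -[X in _ <= X]oppeK leeNr -limn_einfN.
by apply: limn_einf_ge; apply: filterS ul => n; rewrite /= leeN2.
Qed.
End limits.

Lemma cvg_sumr (R : realType) (X : Type) (F : set_system X) {FF : Filter F}
    (I : Type) (r : seq I) (P : pred I) (f : I -> X -> R) (l : I -> R) :
  (forall i, P i -> f i x @[x --> F] --> l i) ->
  \sum_(i <- r | P i) f i x @[x --> F] --> \sum_(i <- r | P i) l i.
Proof. by move=> fl; apply: cvg_big => //; exact: add_continuous. Qed.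

Section hat.
Context (R : realType).

(** The projection of the line onto [0, 1], see [clampE]; written with absolute
    values its continuity is immediate. *)
Definition clamp (t : R) : R := (`|t| - `|t - 1| + 1) / 2.

Lemma clampE t : clamp t = if t <= 0 then 0 else if t <= 1 then t else 1.
Proof.
rewrite /clamp; case: ifPn => [t0|]; first by rewrite !ler0_norm; lra.
rewrite -ltNge => t0; rewrite (gtr0_norm t0); case: ifPn => t1.
  by rewrite ler0_norm; lra.
by rewrite gtr0_norm; lra.
Qed.

Lemma continuous_clamp : continuous clamp.
Proof.
move=> t; apply: cvgM; last exact: cvg_cst.
apply: cvgD; last exact: cvg_cst.
apply: cvgB; first exact: norm_continuous.
by apply: cvg_norm; apply: cvgB; [exact: cvg_id|exact: cvg_cst].
Qed.

Definition hat (t : R) : R := clamp (t + 1) - clamp t.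

Lemma hat_ge0 t : 0 <= hat t.
Proof. by rewrite /hat !clampE; do ! case: ifPn; rewrite -?ltNge; lra. Qed.

Lemma hat_le1 t : hat t <= 1.
Proof. by rewrite /hat !clampE; do ! case: ifPn; rewrite -?ltNge; lra. Qed.

Lemma hat_supp t : hat t != 0 -> `|t| < 1.
Proof.
apply: contraNT; rewrite -leNgt ler_normr => t1.
by apply/eqP; rewrite /hat !clampE; do ! case: ifPn; rewrite -?ltNge; lra.
Qed.

(** For fixed m, piecewise linear bumps of mesh 1/(m+1), centred at
    (j - (m+1)^2)/(m+1). With 2 (m+1)^2 of them they sum to 1 on [-m, m]. *)
Definition tent (m j : nat) (x : R) : R := hat (m.+1%:R * x - j%:R + (m.+1 ^ 2)%:R).

(** A telescoping sum, each bump being a difference of two clamped functions. *)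
Lemma sum_tent m x :
  \sum_(j < (m.+1 ^ 2).*2) tent m j x =
  clamp (m.+1%:R * x + (m.+1 ^ 2)%:R + 1) - clamp (m.+1%:R * x + 1 - (m.+1 ^ 2)%:R).
Proof.
set M := (m.+1 ^ 2)%N; set s := m.+1%:R * x.
rewrite -(big_mkord xpredT (fun j => tent m j x)).
pose F j := - clamp (s - j%:R + M%:R + 1).
rewrite (eq_bigr (fun j => F j.+1 - F j)) => [|j _]; last first.
  rewrite /tent /hat /F -/s -/M opprK addrC; congr (- clamp _ + _).
  by rewrite -natr1; lra.
rewrite telescope_sumr// /F opprK addrC subr0; congr (_ - clamp _).
by rewrite -addnn natrD; lra.
Qed.

Lemma sum_tent_ge0 m x : 0 <= \sum_(j < (m.+1 ^ 2).*2) tent m j x.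
Proof. by apply: sumr_ge0 => j _; exact: hat_ge0. Qed.

Lemma sum_tent_le1 m x : \sum_(j < (m.+1 ^ 2).*2) tent m j x <= 1.
Proof. by rewrite sum_tent !clampE; do ! case: ifPn; rewrite -?ltNge; lra. Qed.

Lemma sum_tent1 m x : `|x| <= m%:R -> \sum_(j < (m.+1 ^ 2).*2) tent m j x = 1.
Proof.
rewrite ler_norml => /andP[x1 x2].
have m0 : 0 <= m%:R :> R by [].
rewrite sum_tent natrX -natr1.
have h1 : - (m%:R + 1) * m%:R <= (m%:R + 1) * x :> R by nra.
have h2 : (m%:R + 1) * x <= (m%:R + 1) * m%:R :> R by nra.
by rewrite !clampE; do ! case: ifPn; rewrite -?ltNge ?expr2; nra.
Qed.

Lemma continuous_tent m j : continuous (tent m j).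
Proof.
have ca (a b : R) : continuous (fun x => a * x + b).
  by move=> x; apply: cvgD; [apply: cvgM; [exact: cvg_cst|exact: cvg_id]|exact: cvg_cst].
rewrite (_ : tent m j = (clamp \o (fun x => m.+1%:R * x + ((m.+1 ^ 2)%:R - j%:R + 1))) \-
  (clamp \o (fun x => m.+1%:R * x + ((m.+1 ^ 2)%:R - j%:R)))); last first.
  by apply/funext => x /=; rewrite /tent /hat; congr (clamp _ - clamp _); lra.
by move=> x; apply: cvgB; apply: continuous_comp; (exact: ca || exact: continuous_clamp).
Qed.

Lemma tent_bounded m j : bounded_fun (tent m j).
Proof.
exists 1; split => // M M1 x _; apply: le_trans (ltW M1).
by rewrite ger0_norm ?hat_ge0// hat_le1.
Qed.

Definition tent_bc m j : bounded_continuous R :=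
  exist _ (tent m j) (conj (@continuous_tent m j) (@tent_bounded m j)).
End hat.

(** * Lower semicontinuity of the energy *)

Section weak_integrals.
Context (R : realType).
Local Notation T := (measurableTypeR R).

Lemma bounded_continuous_measurable (f : bounded_continuous R) :
  measurable_fun [set: T] (sval f : T -> R).
Proof. by apply: continuous_measurable_fun; case: (svalP f). Qed.

Lemma bounded_continuous_integrable (nu : probability T R) (f : bounded_continuous R) :
  nu.-integrable setT (fun x : T => (sval f x)%:E).
Proof.
have nu1 : (nu setT < +oo)%E by rewrite [X in (X < _)%E](probability_setT nu) ltry.
have bf : [bounded sval f x | x in [set: T]] by case: (svalP f).
exact: (measurable_bounded_integrable measurableT nu1 (bounded_continuous_measurable f) bf).
Qed.

Lemma integralsE (nu : probability T R) (f : bounded_continuous R) :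
  (\int[nu]_x (sval f x)%:E)%E = (integrals nu f)%:E.
Proof.
rewrite /integrals /Rintegral fineK//.
exact: (integrable_fin_num measurableT (bounded_continuous_integrable nu f)).
Qed.
End weak_integrals.

(** The energy is a supremum of weakly continuous functions. A nonnegative
    continuous kernel h is approached from below by the functions [step m], finite sums of
    products of bumps whose coefficients are the infima of h over small cells.
    The double integral of [step m] is a polynomial in finitely many integrals of
    bounded continuous functions, hence weakly continuous, and Fatou's lemma
    recovers the energy of h in the limit. *)
Section energy_lsc.
Context (R : realType).
Local Notation T := (measurableTypeR R).
Variable h : R * R -> R.
Hypothesis ch : continuous h.
Hypothesis h0 : forall u, 0 <= h u.

(** [tent m j] is [hat] composed with [off m j], so a cell contains the points where
    neither of its two bumps vanishes. *)
Let off m (j : nat) (x : R) : R := m.+1%:R * x - j%:R + (m.+1 ^ 2)%:R.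
Let cell m (p q : nat) : set (R * R) :=
  [set u | `|off m p u.1| < 1 /\ `|off m q u.2| < 1].
Let coef m p q : R := inf (h @` cell m p q).

Let cellP m p q : has_inf (h @` cell m p q).
Proof.
split; last by exists 0 => _ [u _ <-]; exact: h0.
pose c (j : nat) : R := (j%:R - (m.+1 ^ 2)%:R) / m.+1%:R.
have offc j : off m j (c j) = 0.
  by rewrite /off /c; have : m.+1%:R != 0 :> R by []; move=> ?; field.
by exists (h (c p, c q)); exists (c p, c q) => //; rewrite /cell/= !offc normr0.
Qed.

Let coef_ge0 m p q : 0 <= coef m p q.
Proof.
by apply: lb_le_inf; [case: (cellP m p q)|move=> _ [u _ <-]; exact: h0].
Qed.

Let step m (u : T * T) : R :=
  \sum_(p < (m.+1 ^ 2).*2) \sum_(q < (m.+1 ^ 2).*2)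
    coef m p q * (tent m p u.1 * tent m q u.2).

Let step_bound m (u : T * T) c :
  \sum_(p < (m.+1 ^ 2).*2) \sum_(q < (m.+1 ^ 2).*2) c * (tent m p u.1 * tent m q u.2)
  = c * ((\sum_(p < (m.+1 ^ 2).*2) tent m p u.1) * (\sum_(q < (m.+1 ^ 2).*2) tent m q u.2)).
Proof.
rewrite mulr_suml mulr_sumr; apply: eq_bigr => p _.
by rewrite mulr_sumr mulr_sumr.
Qed.

Let step_le m u : step m u <= h u.
Proof.
apply: (@le_trans _ _ (\sum_(p < (m.+1 ^ 2).*2) \sum_(q < (m.+1 ^ 2).*2)
    h u * (tent m p u.1 * tent m q u.2))).
  apply: ler_sum => p _; apply: ler_sum => q _.
  have [->|/hat_supp t1] := eqVneq (tent m p u.1) 0; first by rewrite mul0r !mulr0.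
  have [->|/hat_supp t2] := eqVneq (tent m q u.2) 0; first by rewrite !mulr0.
  apply: ler_wpM2r; first by rewrite mulr_ge0// hat_ge0.
  by apply: ge_inf; [case: (cellP m p q)|exists u].
rewrite step_bound -[leRHS]mulr1; apply: ler_wpM2l => //.
by rewrite mulr_ile1 ?sum_tent_ge0 ?sum_tent_le1.
Qed.

Let step_ge u e : 0 < e -> \forall m \near \oo, h u - e <= step m u.
Proof.
move=> e0.
have /nbhs_ballP[r /= r0 sub] : nbhs u (h @^-1` [set y | h u - e < y]).
  by apply: ch; apply: open_nbhs_nbhs; split; [exact: open_gt|rewrite /=; lra].
have big (c : R) : \forall m \near \oo, c <= m%:R.
  exact: nbhs_infty_ger.
near=> m.
have m1 : `|u.1| <= m%:R by near: m; exact: big.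
have m2 : `|u.2| <= m%:R by near: m; exact: big.
have mr : 2 / r < m.+1%:R.
  have : 2 / r <= m%:R by near: m; exact: big.
  by rewrite -natr1; lra.
(* m is so large that u lies in [-m, m]^2, where the bumps sum to 1, and that
   cells, of width 2/(m+1), are smaller than r. *)
have -> : h u - e = \sum_(p < (m.+1 ^ 2).*2) \sum_(q < (m.+1 ^ 2).*2)
    (h u - e) * (tent m p u.1 * tent m q u.2).
  by rewrite step_bound !sum_tent1// !mulr1.
apply: ler_sum => p _; apply: ler_sum => q _.
have [->|/hat_supp t1] := eqVneq (tent m p u.1) 0; first by rewrite mul0r !mulr0.
have [->|/hat_supp t2] := eqVneq (tent m q u.2) 0; first by rewrite !mulr0.
apply: ler_wpM2r; first by rewrite mulr_ge0// hat_ge0.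
have near1 (j : nat) x y : `|off m j x| < 1 -> `|off m j y| < 1 -> `|x - y| < r.
  move=> jx jy; have m0 : 0 < m.+1%:R :> R by [].
  rewrite -(ltr_pM2l m0) -{1}(gtr0_norm m0) -normrM.
  apply: (@lt_trans _ _ 2); last by rewrite -ltr_pdivrMr.
  move: jx jy; rewrite /off !ltr_norml => /andP[? ?] /andP[? ?]; rewrite mulrBr; lra.
apply: lb_le_inf; first by case: (cellP m p q).
move=> _ [[v1 v2] [/= c1 c2] <-]; apply/ltW/sub; split => /=.
  by apply: (near1 p).
by apply: (near1 q).
Unshelve. all: by end_near. Qed.

Let integral_tensor (nu : probability T R) (f1 f2 : bounded_continuous R) :
  (forall x, 0 <= sval f1 x) -> (forall x, 0 <= sval f2 x) ->
  (\int[nu \x nu]_u (sval f1 u.1 * sval f2 u.2)%:E =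
   (integrals nu f1 * integrals nu f2)%:E)%E.
Proof.
move=> f10 f20.
have m1 := bounded_continuous_measurable f1.
have m2 := bounded_continuous_measurable f2.
have m12 : measurable_fun setT (fun u : T * T => (sval f1 u.1 * sval f2 u.2)%:E).
  apply/measurable_EFinP; apply: measurable_funM.
    exact: (measurableT_comp m1 measurable_fst).
  exact: (measurableT_comp m2 measurable_snd).
rewrite (fubini_tonelli1 _ m12)/fubini_F/=; last by move=> u; rewrite lee_fin mulr_ge0.
under eq_integral => x _.
  under eq_integral do rewrite EFinM.
  rewrite ge0_integralZl_EFin ?integralsE//; last 2 first.
  - by move=> y _; rewrite lee_fin.
  - exact/measurable_EFinP.
  over.
rewrite ge0_integralZr ?integralsE//; last 3 first.
- exact/measurable_EFinP.
- by move=> x _; rewrite lee_fin.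
- by rewrite -integralsE; apply: integral_ge0 => x _; rewrite lee_fin.
Qed.

Let mean m (nu : probability T R) : R :=
  \sum_(p < (m.+1 ^ 2).*2) \sum_(q < (m.+1 ^ 2).*2)
    coef m p q * (integrals nu (tent_bc R m p) * integrals nu (tent_bc R m q)).

Let term_ge0 m p q (u : T * T) : 0 <= coef m p q * (tent m p u.1 * tent m q u.2).
Proof. by rewrite mulr_ge0// mulr_ge0// hat_ge0. Qed.

Let measurable_tensor m p q :
  measurable_fun setT (fun u : T * T => tent m p u.1 * tent m q u.2).
Proof.
apply: measurable_funM.
  exact: (measurableT_comp (bounded_continuous_measurable (tent_bc R m p)) measurable_fst).
exact: (measurableT_comp (bounded_continuous_measurable (tent_bc R m q)) measurable_snd).
Qed.

Let measurable_term m p q :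
  measurable_fun setT (fun u : T * T => coef m p q * (tent m p u.1 * tent m q u.2)).
Proof. exact: measurable_funM. Qed.

Let measurable_step m : measurable_fun setT (step m).
Proof. by apply: measurable_sum => p; apply: measurable_sum => q. Qed.

Let integral_step (nu : probability T R) m :
  (\int[nu \x nu]_u (step m u)%:E = (mean m nu)%:E)%E.
Proof.
rewrite /step; under eq_integral do rewrite -sumEFin.
rewrite ge0_integral_sum//; last 2 first.
- by move=> p; apply/measurable_EFinP/measurable_sum => q.
- by move=> p u _; rewrite lee_fin sumr_ge0.
rewrite /mean -sumEFin; apply: eq_bigr => p _.
under eq_integral do rewrite -sumEFin.
rewrite ge0_integral_sum//; last 2 first.
- by move=> q; exact/measurable_EFinP.
- by move=> q u _; rewrite lee_fin.
rewrite -sumEFin; apply: eq_bigr => q _.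
under eq_integral do rewrite EFinM.
rewrite ge0_integralZl_EFin//; last 2 first.
- by move=> u _; rewrite lee_fin mulr_ge0// hat_ge0.
- exact/measurable_EFinP.
rewrite EFinM; congr (_ * _)%E.
by apply: (@integral_tensor nu (tent_bc R m p) (tent_bc R m q)) => x; exact: hat_ge0.
Qed.

Let mean_continuous m : continuous (mean m : borel_probability R -> R).
Proof.
move=> nu; have FF := nbhs_filter (nu : borel_probability R).
apply: cvg_sumr => p _; apply: cvg_sumr => q _.
apply: cvgM; first exact: cvg_cst.
by apply: cvgM; exact: weak_continuous.
Qed.

Lemma energy_lower_semicontinuous : lower_semicontinuous (@energy R h).
Proof.
move=> nu a anu.
have mh := measurable_continuous2 ch.
have mEh : measurable_fun setT (fun u : T * T => (h u)%:E) by exact/measurable_EFinP.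
have [m am] : exists m, a < mean m nu.
  apply: contrapT => /forallNP am.
  have : (energy h nu <= a%:E)%E.
    have mst m : measurable_fun setT (fun u : T * T => (step m u)%:E).
      exact/measurable_EFinP.
    have st0 m (u : T * T) : setT u -> (0 <= (step m u)%:E)%E.
      by move=> _; rewrite lee_fin sumr_ge0// => p _; rewrite sumr_ge0.
    apply: (@le_trans _ _ (limn_einf (fun m => \int[nu \x nu]_u (step m u)%:E))%E).
      apply: le_trans (fatou _ measurableT mst st0).
      rewrite /energy le_eqVlt; apply/orP; left; apply/eqP.
      apply: eq_integral => u _; apply/eqP; rewrite eq_le; apply/andP; split.
        apply/lee_subgt0Pr => e e0; apply: limn_einf_ge.
        by apply: filterS (step_ge u e0) => m; rewrite -EFinB lee_fin.
      apply: (le_trans (limn_einf_sup _)); apply: limn_esup_le; apply: nearW => m.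
      by rewrite lee_fin.
    apply: (le_trans (limn_einf_sup _)); apply: limn_esup_le; apply: nearW => m.
    by rewrite integral_step lee_fin leNgt; apply/negP/am.
  by rewrite leNgt anu.
exists [set nu' | a < mean m nu'].
  apply: (@mean_continuous m nu [set y | a < y]); apply: open_nbhs_nbhs.
  by split; [exact: open_gt|].
move=> nu' /= am'; apply: (@lt_le_trans _ _ (mean m nu')%:E); first by rewrite lte_fin.
rewrite -integral_step; apply: ge0_le_integral => //.
- by move=> u _; rewrite lee_fin sumr_ge0// => p _; rewrite sumr_ge0.
- exact/measurable_EFinP.
- by move=> u _; rewrite lee_fin.
Qed.
End energy_lsc.

(** * Finite samples of small self-interaction *)

Section has_mean.
Context (R : realType).
Local Notation T := (measurableTypeR R).
Variable nu : probability T R.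

(** Integrability and the value of the integral are carried together, so that
    means of compound expressions are computed along with their existence. *)
Definition has_mean (f : T -> R) (m : R) : Prop :=
  nu.-integrable setT (EFin \o f) /\ \int[nu]_x f x = m.

Lemma has_mean_cst c : has_mean (fun=> c) c.
Proof.
have nu1 : (nu setT < +oo)%E by rewrite [X in (X < _)%E](probability_setT nu) ltry.
split; first exact: finite_measure_integrable_cst.
by rewrite Rintegral_cst// [X in fine X](probability_setT nu) mulr1.
Qed.

Lemma has_meanD f g m1 m2 : has_mean f m1 -> has_mean g m2 ->
  has_mean (fun x => f x + g x) (m1 + m2).
Proof.
move=> [if1 fm] [ig gm]; split; last by rewrite RintegralD// fm gm.
exact: (integrableD measurableT if1 ig).
Qed.

Lemma has_meanZ c f m : has_mean f m -> has_mean (fun x => c * f x) (c * m).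
Proof.
move=> [if1 fm]; split; last by rewrite RintegralZl// fm.
exact: (integrableZl measurableT c if1).
Qed.

Lemma has_mean_sum (I : Type) (s : seq I) (f : I -> T -> R) (m : I -> R) :
  (forall i, has_mean (f i) (m i)) ->
  has_mean (fun x => \sum_(i <- s) f i x) (\sum_(i <- s) m i).
Proof.
move=> fm; elim: s => [|i s IH].
  rewrite big_nil; under [X in has_mean X]eq_fun do rewrite big_nil.
  exact: has_mean_cst.
rewrite big_cons; under [X in has_mean X]eq_fun do rewrite big_cons.
exact: has_meanD.
Qed.

Lemma has_mean_between (c : R) (f g : T -> R) m : measurable_fun [set: T] f ->
  has_mean g m -> (forall x, c <= f x <= g x) ->
  exists mf, has_mean f mf.
Proof.
move=> mf gm cfg; exists (\int[nu]_x f x); split => //.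
have [ig _] := has_meanD gm (has_mean_cst (`|c| + `|c|)).
apply: le_integrable ig => //; first exact/measurable_EFinP.
move=> x _ /=; rewrite lee_fin.
have /andP[h1 h2] := cfg x.
have c1 := ler_norm c; have c2 := ler_norm (- c); rewrite normrN in c2.
rewrite [leRHS]ger0_norm; last by lra.
by rewrite ler_norml; apply/andP; split; lra.
Qed.

Lemma has_mean_le f m : has_mean f m -> exists x, f x <= m.
Proof.
move=> [if1 fm]; apply: contrapT => /forallNP H.
have H' x : 0 < f x - m by rewrite subr_gt0 ltNge; apply/negP/H.
have [ig g0] := has_meanD (conj if1 fm) (has_mean_cst (- m)).
have mg : measurable_fun [set: T] (fun x => (f x - m)%:E) by exact: (measurable_int nu ig).
have /(ae_eq_integral_abs nu measurableT mg) : (\int[nu]_x `|(f x - m)%:E| = 0)%E.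
  under eq_integral do rewrite gee0_abs ?lee_fin ?ltW//.
  rewrite subrr in g0.
  have := integrable_fin_num measurableT ig => /fineK <-.
  by rewrite -[X in _ = X%:E]g0.
case => N [mN N0 sub].
have : nu setT = 0%E.
  apply/eqP; rewrite -measure_le0 -N0 le_measure ?inE// => x _; apply: sub => /=.
  by move=> /(_ I) /eqP; rewrite /= eqe gt_eqF.
by rewrite [LHS](probability_setT nu) => -[] /eqP; rewrite oner_eq0.
Qed.
End has_mean.

Section averaging.
Context (R : realType).
Local Notation T := (measurableTypeR R).
Variables (nu : probability T R) (q : R * R -> R) (U : R -> R) (E D : R).
Hypothesis qC : forall x y, q (x, y) = q (y, x).
Hypothesis qU : forall x, has_mean nu (fun y => q (x, y)) (U x).
Hypothesis UE : has_mean nu U E.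
Hypothesis qD : has_mean nu (fun x => q (x, x)) D.

Definition self_energy (s : seq R) : R := \sum_(x <- s) \sum_(y <- s) q (x, y).

Lemma self_energy_rcons s x :
  self_energy (rcons s x) = self_energy s + 2 * \sum_(y <- s) q (y, x) + q (x, x).
Proof.
rewrite /self_energy -cats1 big_cat big_seq1 /=.
under eq_bigr do rewrite big_cat big_seq1 /=.
rewrite big_split /= big_cat big_seq1 /=.
under [X in _ + (X + _) = _]eq_bigr do rewrite qC.
ring.
Qed.

(** The right-hand side is the expected self-interaction of s extended by r
    independent points drawn from nu. Points are added one at a time: since some
    value of a function is at most its mean, each new point can be chosen so that
    the conditional expectation of the final value does not increase. *)
Lemma sample_extension r s : exists2 a : seq R, size a = r &
  self_energy (s ++ a) <= self_energy s + 2 * r%:R * \sum_(x <- s) U x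
    + (r%:R ^+ 2 - r%:R) * E + r%:R * D.
Proof.
elim: r s => [|r IH] s; first by exists [::] => //; rewrite cats0; lra.
have [x hx] := has_mean_le (has_meanD (has_meanD
  (has_meanZ 2 (has_mean_sum s qU)) qD) (has_meanZ (2 * r%:R) UE)).
have [a ar ha] := IH (rcons s x).
exists (x :: a); first by rewrite /= ar.
rewrite -cat_rcons; apply: (le_trans ha).
rewrite self_energy_rcons -cats1 big_cat big_seq1 /= -natr1.
nra.
Qed.

Lemma small_self_energy r : exists2 a : seq R, size a = r &
  self_energy a <= (r%:R ^+ 2 - r%:R) * E + r%:R * D.
Proof.
have [a ar] := sample_extension r [::].
by rewrite cat0s /self_energy !big_nil mulr0 !add0r => ?; exists a.
Qed.
End averaging.

(** * Energies of a negative definite kernel bounded below *)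

(** The integral of f may be infinite, so additivity is applied to the
    nonnegative functions f + c, c and the two parts of f, the integral of the
    negative part being at most c. *)
Lemma integral_shift d (X : measurableType d) (R : realType)
    (mu : {measure set X -> \bar R}) (f : X -> R) (c : R) :
  mu setT = 1%E -> measurable_fun setT f -> 0 <= c -> (forall x, 0 <= f x + c) ->
  (\int[mu]_x (f x + c)%:E = \int[mu]_x (f x)%:E + c%:E)%E.
Proof.
move=> mu1 mf c0 fc0.
have mEf : measurable_fun setT (EFin \o f) by exact/measurable_EFinP.
have ic : (\int[mu]_x (cst c%:E x) = c%:E)%E by rewrite integral_cst// mu1 mule1.
have negle x : ((EFin \o f)^\-%E x <= cst c%:E x)%E.
  rewrite funerneg /= lee_fin /funrneg ge_max c0 andbT.
  by have := fc0 x; lra.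
have neg_lt : (\int[mu]_x (EFin \o f)^\-%E x \is a fin_num)%E.
  rewrite ge0_fin_numE; last by apply: integral_ge0 => x _; exact: funeneg_ge0.
  rewrite (@le_lt_trans _ _ c%:E) ?ltry// -ic; apply: ge0_le_integral => //.
  exact: measurable_funeneg.
have key : (\int[mu]_x (f x + c)%:E + \int[mu]_x (EFin \o f)^\-%E x =
    \int[mu]_x (EFin \o f)^\+%E x + c%:E)%E.
  rewrite -[in RHS]ic -!ge0_integralD//; last 4 first.
  - exact: measurable_funepos.
  - by move=> x _; rewrite lee_fin.
  - by apply/measurable_EFinP; exact: measurable_funD.
  - exact: measurable_funeneg.
  apply: eq_integral => x _; rewrite funerneg funerpos /= -!EFinD; congr (_%:E).
  have fx : f^\+ x - f^\- x = f x by rewrite -[in RHS](funrposBneg f).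
  lra.
rewrite [X in (_ = X + _)%E]integralE addeAC -key addeK//.
Qed.

Section energy_facts.
Context (R : realType).
Local Notation T := (measurableTypeR R).
Variables (k : R * R -> R) (k0 : R).
Hypothesis ck : continuous k.
Hypothesis kk0 : forall u, k0 <= k u.
Implicit Type nu : borel_probability R.

Let mk : measurable_fun [set: (T * T)%type] k := measurable_continuous2 ck.

Lemma product_setT (nu : probability T R) : ((nu \x nu) setT = 1)%E.
Proof.
rewrite -setXTT product_measure1E//.
by rewrite [X in (X * _)%E](probability_setT nu) [X in (_ * X)%E](probability_setT nu) mule1.
Qed.

Let k_shift u : 0 <= k u + `|k0|.
Proof.
by have := kk0 u; have := ler_norm (- k0); rewrite normrN; lra.
Qed.

Lemma energy_shift nu :
  (energy (fun u => k u + `|k0|)%R nu = energy k nu + `|k0|%:E)%E.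
Proof.
exact: (integral_shift (product_setT nu)).
Qed.

Lemma energy_lsc : lower_semicontinuous (@energy R k).
Proof.
move=> nu a anu.
have ck' : continuous (fun u => k u + `|k0|).
  by move=> u; apply: cvgD; [exact: ck|exact: cvg_cst].
have := @energy_lower_semicontinuous R _ ck' k_shift nu (a + `|k0|).
rewrite energy_shift EFinD lteD2rE// => /(_ anu)[V nV HV].
by exists V => // y /HV; rewrite energy_shift lteD2rE.
Qed.

Lemma energy_ge nu : (k0%:E <= energy k nu)%E.
Proof.
rewrite -(leeD2rE _ _ (isT : `|k0|%:E \is a fin_num)) -energy_shift /energy.
pose mu : probability T R := nu.
have -> : (k0%:E + `|k0|%:E = \int[mu \x mu]_u cst (k0 + `|k0|)%:E u)%E.
  by rewrite integral_cst// [X in (_ * X)%E](product_setT nu) mule1.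
apply: ge0_le_integral => //.
- by move=> u _; rewrite lee_fin; have := ler_norm (- k0); rewrite normrN; lra.
- by apply/measurable_EFinP; exact: measurable_funD.
- by move=> u _; rewrite lee_fin lerD2r.
Qed.

Lemma energy_integrable (nu : probability T R) : (energy k nu < +oo)%E ->
  (nu \x nu)%E.-integrable setT (EFin \o k).
Proof.
move=> knu; apply/integrableP; split; first exact/measurable_EFinP.
apply: (@le_lt_trans _ _ (energy (fun u => k u + `|k0|)%R nu + (`|k0| + `|k0|)%:E)%E); last first.
  rewrite energy_shift; apply: lte_add_pinfty; last exact: ltry.
  by apply: lte_add_pinfty => //; exact: ltry.
rewrite -[X in (_ + X)%E](_ : (\int[nu \x nu]_u cst (`|k0| + `|k0|)%:E u)%E = _); last first.
  by rewrite integral_cst// [X in (_ * X)%E](product_setT nu) mule1.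
rewrite -ge0_integralD//; last 3 first.
- by move=> u _; rewrite lee_fin.
- by apply/measurable_EFinP; exact: measurable_funD.
- by move=> u _; rewrite lee_fin.
apply: ge0_le_integral => //.
- by apply/measurable_EFinP; exact: measurableT_comp.
- by apply/measurable_EFinP; apply: measurable_funD => //; exact: measurable_funD.
- move=> u _; rewrite /= -EFinD lee_fin ler_norml.
  have := k_shift u; have : 0 <= `|k0| by []. lra.
Qed.

Hypothesis knd : negative_definite k.

Lemma negdef2 x y : k (x, x) + k (y, y) <= 2 * k (x, y).
Proof.
have [kC /(_ 2%N (fun i => nth 0 [:: x; y] i) (fun i => nth 0 [:: 1; -1] i))] := knd.
rewrite !big_ord_recl !big_ord0 /= => /(_ ltac:(lra)); rewrite (kC y x); lra.
Qed.

(** The coefficients 1, 1, -2 at the points a, y, z. *)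
Lemma negdef3 a y z :
  k (a, a) + k (y, y) + 4 * k (z, z) + 2 * k (a, y) - 4 * k (a, z) - 4 * k (z, y) <= 0.
Proof.
have [kC /(_ 3%N (fun i => nth 0 [:: a; y; z] i) (fun i => nth 0 [:: 1; 1; -2] i))] := knd.
rewrite !big_ord_recl !big_ord0 /= => /(_ ltac:(lra)); rewrite (kC y a) (kC z a) (kC y z); lra.
Qed.

(** Finiteness of the energy only makes k (z, .) integrable for almost every z.
    One such z suffices: by [negdef3], a triangle inequality up to a factor 2,
    k (x, y) is bounded by 2 k (z, y) plus a quantity depending on x alone. The
    diagonal is bounded by 2 U through [negdef2]. *)
Lemma finite_energy_means (nu : probability T R) : (energy k nu < +oo)%E ->
  exists (U : R -> R) (D : R), [/\ forall x, has_mean nu (fun y => k (x, y)) (U x),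
    has_mean nu U (fine (energy k nu)) & has_mean nu (fun x => k (x, x)) D].
Proof.
move=> knu; have ik := energy_integrable knu.
have mk1 x : measurable_fun [set: T] (fun y : T => k (x, y)).
  exact: (measurableT_comp mk (pair1_measurable x)).
have [z iz] : exists z, nu.-integrable setT (fun y => (k (z, y))%:E).
  apply: contrapT => /forallNP H.
  have [N [mN N0 sub]] := ae_integrable1 ik.
  have : nu setT = 0%E.
    apply/eqP; rewrite -measure_le0 -N0 le_measure ?inE// => x _; apply: sub => /=.
    exact: H.
  by rewrite [LHS](probability_setT nu) => -[] /eqP; rewrite oner_eq0.
have km x : exists m, has_mean nu (fun y => k (x, y)) m.
  apply: (@has_mean_between _ _ k0 _ (fun y => 2 * k (z, y) +
    (2 * k (x, z) - k (x, x) / 2 - 2 * k (z, z) - k0 / 2))) => //.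
    apply: has_meanD; last exact: has_mean_cst.
    by apply: has_meanZ; split; [exact: iz|reflexivity].
  move=> y; rewrite kk0 /=; have := negdef3 x y z; have := kk0 (y, y); lra.
pose U x : R := \int[nu]_y k (x, y).
have kU x : has_mean nu (fun y => k (x, y)) (U x).
  by have [m [im _]] := km x; split.
have FU : fubini_F nu (EFin \o k) = EFin \o U.
  apply/funext => x; rewrite /fubini_F /U /Rintegral /= fineK//.
  by have [im _] := kU x; exact: (integrable_fin_num measurableT im).
have UE : has_mean nu U (fine (energy k nu)).
  split; first by rewrite -FU; exact: integrable_fubini_F.
  have h : (\int[nu]_x (EFin \o U) x = energy k nu)%E.
    by rewrite -FU; exact: (integral12_prod_meas1 ik).
  by rewrite /Rintegral; congr fine; exact: h.
have [D kD] : exists D, has_mean nu (fun x => k (x, x)) D.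
  apply: (@has_mean_between _ _ k0 _ (fun x => 2 * U x + - k0)).
  - by apply: (measurableT_comp mk); exact: measurable_fun_pair.
  - by apply: has_meanD; [exact: has_meanZ UE|exact: has_mean_cst].
  move=> x; rewrite kk0 /=.
  have [y] : exists y, k (x, y) <= U x by exact: has_mean_le (kU x).
  by have := negdef2 x y; have := kk0 (y, y); lra.
by exists U, D.
Qed.
End energy_facts.

(** * Approximation by uniform measures on finitely many points *)

Lemma integrals_average (R : realType) n
    (z : n.+1.-tuple (measurableTypeR R) * n.+1.-tuple (measurableTypeR R))
    (f : bounded_continuous R) :
  integrals (average_empirical_measure z) f = sample_mean z (sval f).
Proof.
rewrite /integrals /Rintegral integral_average//.
exact: bounded_continuous_measurable.
Qed.

Lemma sample_mean_diag (R : realType) n (t : n.+1.-tuple (measurableTypeR R)) (f : R -> R) :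
  sample_mean (t, t) f = n.+1%:R^-1 * \sum_(x <- t) f x.
Proof.
rewrite /sample_mean big_tuple big_split /= natrM.
have : n.+1%:R != 0 :> R by rewrite pnatr_eq0.
by move=> ?; field.
Qed.

Lemma List_In_le_sum (R : realType) (I : Type) (s : seq I) (F : I -> R) i :
  (forall j, 0 <= F j) -> List.In i s -> F i <= \sum_(j <- s) F j.
Proof.
move=> F0; elim: s => //= j s IH [->|/IH h]; rewrite big_cons.
  by rewrite lerDl sumr_ge0.
by rewrite (le_trans h)// lerDr.
Qed.

Section approximation.
Context (R : realType).
Local Notation T := (measurableTypeR R).
Variables (k : R * R -> R) (k0 : R).
Hypothesis ck : continuous k.
Hypothesis kk0 : forall u, k0 <= k u.
Hypothesis knd : negative_definite k.

(** Averaging over samples is applied to k + K * sum of phi_f (x) phi_f (y), where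
    f runs over the test functions defining a weak neighbourhood of nu in G and
    phi_f is f minus its mean. The added part has mean 0 and the self-interaction
    of a sample of size N turns it into K times the sum of the squared
    fluctuations. Hence one and the same sample has energy at most that of nu up
    to O(1/N) and, for K large, integrates every f almost as nu does. *)
Lemma energy_approximation (nu : borel_probability R) (G : set (borel_probability R)) e :
  open G -> G nu -> (energy k nu < +oo)%E -> 0 < e ->
  exists n (t : n.+1.-tuple T), G (average_empirical_measure (t, t)) /\
    interaction k (t, t) <= n.+1%:R ^+ 2 * (fine (energy k nu) + e).
Proof.
move=> oG Gnu knu e0.
have [fs [eta [eta0 Gfs]]] := weak_open_nbhs oG Gnu.
have [U [D [kU UE kD]]] := finite_energy_means ck kk0 knd knu.
set E := fine (energy k nu) in UE *.
have k0E : k0 <= E.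
  have h := energy_ge ck kk0 nu.
  rewrite -lee_fin fineK// fin_numElt knu andbT.
  exact: lt_le_trans (ltNyr k0) h.
pose phi (f : bounded_continuous R) x := sval f x - integrals nu f.
have phi0 f : has_mean nu (phi f) 0.
  rewrite -(subrr (integrals nu f)); apply: has_meanD; last exact: has_mean_cst.
  by split; [exact: bounded_continuous_integrable|].
pose v f := \int[nu]_x (phi f x * phi f x).
have phiv f : has_mean nu (fun x => phi f x * phi f x) (v f).
  have [M Mf] : exists M, forall x, `|sval f x| <= M.
    have [_ [B [_ HB]]] := svalP f.
    exists (B + 1) => x; apply: HB => //; lra.
  have [mv hv] : exists m, has_mean nu (fun x => phi f x * phi f x) m.
    apply: (@has_mean_between _ _ 0 _ (fun=> (M + `|integrals nu f|) ^+ 2)).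
    - by apply: measurable_funM; apply: measurable_funB => //; exact: bounded_continuous_measurable.
    - exact: has_mean_cst.
    move=> x; rewrite -expr2 sqr_ge0/= -real_normK ?num_real//.
    rewrite lerXn2r ?nnegrE//; first by rewrite addr_ge0// (le_trans _ (Mf x)).
    by apply: (le_trans (ler_normB _ _)); rewrite lerD2r.
  by case: hv => hv _; split.
(* K eta^2 exceeds E + e - k0, the largest possible drop of the energy of a
   sample below E + e. *)
pose K := (E + e - k0) / eta ^+ 2 + 1.
have K0 : 0 < K by rewrite /K ltr_wpDl// divr_ge0 ?sqr_ge0//; lra.
pose q (u : R * R) := k u + K * \sum_(f <- fs) phi f u.1 * phi f u.2.
have qC x y : q (x, y) = q (y, x).
  rewrite /q /=; have [-> _] := knd; congr (_ + _ * _).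
  by apply: eq_bigr => f _; rewrite mulrC.
have qU x : has_mean nu (fun y => q (x, y)) (U x).
  have := has_meanD (kU x) (has_meanZ K (has_mean_sum fs
     (fun f => has_meanZ (phi f x) (phi0 f)))).
  by rewrite [X in has_mean _ _ (_ + K * X)]big1 ?mulr0 ?addr0// => f _; rewrite mulr0.
have qD := has_meanD kD (has_meanZ K (has_mean_sum fs phiv)).
set Dq := (D + _) in qD.
(* The sample size absorbs Dq - E, which grows with K: n depends on K. *)
pose n := Num.truncn (`|Dq - E| / e).
have nDq : Dq - E <= n.+1%:R * e.
  rewrite (le_trans (ler_norm _))// -ler_pdivrMr// ltW// truncnS_gt//.
have [a an ha] := small_self_energy qC qU UE qD n.+1.
pose t : n.+1.-tuple T := tcast an (in_tuple a).
have ta : t = a :> seq R by rewrite val_tcast.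
have SE : self_energy q a = interaction k (t, t) + K * \sum_(f <- fs) (\sum_(x <- a) phi f x) ^+ 2.
  have -> : interaction k (t, t) = \sum_(x <- a) \sum_(y <- a) k (x, y).
    rewrite /interaction -ta big_tuple; apply: eq_bigr => i _.
    by rewrite big_tuple.
  rewrite /self_energy /q /=; under eq_bigr do rewrite big_split -mulr_sumr /=.
  rewrite big_split -mulr_sumr /=; congr (_ + K * _).
  under eq_bigr do rewrite exchange_big /=.
  rewrite exchange_big /=; apply: eq_bigr => f _.
  rewrite expr2 mulr_suml; apply: eq_bigr => x _.
  by rewrite mulr_sumr.
have lowS := interaction_ge_min (t, t) kk0.
have N0 : 0 < n.+1%:R :> R by [].
have upS : self_energy q a <= n.+1%:R ^+ 2 * (E + e).
  apply: (le_trans ha); have : n.+1%:R * (Dq - E) <= n.+1%:R * (n.+1%:R * e) by rewrite ler_pM2l.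
  rewrite expr2; lra.
exists n, t; split; last first.
  apply: le_trans upS; rewrite SE lerDl mulr_ge0//; first exact: ltW.
  by apply: sumr_ge0 => f _; exact: sqr_ge0.
apply: Gfs => f fin.
rewrite integrals_average sample_mean_diag ta.
have -> : n.+1%:R^-1 * \sum_(x <- a) sval f x - integrals nu f = (\sum_(x <- a) phi f x) / n.+1%:R.
  rewrite /phi sumrB mulrBl mulrC; congr (_ - _).
  rewrite big_const_seq count_predT an iter_addr addr0 -(mulr_natl (integrals nu f)).
  by rewrite mulrAC divff ?mul1r// pnatr_eq0.
rewrite -ltr_sqr ?nnegrE ?normr_ge0 ?ltW// -normrX ger0_norm ?sqr_ge0//.
have h : K * (\sum_(x <- a) phi f x) ^+ 2 <= n.+1%:R ^+ 2 * (E + e - k0).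
  have := List_In_le_sum (fun f => sqr_ge0 (\sum_(x <- a) phi f x)) fin.
  rewrite -(ler_pM2l K0) => /le_trans; apply.
  by move: upS; rewrite SE; lra.
rewrite expr_div_n ltr_pdivrMr ?exprn_gt0//.
rewrite -(ltr_pM2l K0); apply: (le_lt_trans h).
rewrite [ltRHS]mulrA [ltRHS]mulrC ltr_pM2l ?exprn_gt0//.
by rewrite /K mulrDl divfK ?mul1r; [have := exprn_gt0 2 eta0; lra|rewrite gt_eqF// exprn_gt0].
Qed.
End approximation.

(** * Continuity of the empirical measure and periodic configurations *)

Section close_filter.
Context (R : realType) (n : nat).
Local Notation T := (measurableTypeR R).

Definition close_filter (z : n.-tuple R * n.-tuple R) :
    set_system (n.-tuple R * n.-tuple R) :=
  filter_from [set r : R | 0 < r] (fun r => close r z).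

Lemma close_filter_filter z : Filter (close_filter z).
Proof.
apply: filter_from_filter; first by exists 1 => /=.
move=> r s /= r0 s0; exists (Num.min r s); first by rewrite /= lt_min r0.
by move=> z' h; split=> i; have [] := h i; rewrite !lt_min => /andP[? ?] /andP[].
Qed.
End close_filter.

Section empirical_continuity.
Context (R : realType) (n : nat).
Local Notation T := (measurableTypeR R).

Lemma average_empirical_continuous (z : n.+1.-tuple T * n.+1.-tuple T) :
  (fun z' : n.+1.-tuple T * n.+1.-tuple T => average_empirical_measure z') @ close_filter z -->
  average_empirical_measure z.
Proof.
have FF := close_filter_filter z.
apply: weak_cvg => f; rewrite integrals_average.
rewrite (_ : _ @ _ = (fun z' => sample_mean z' (sval f)) @ close_filter z); last first.
  by apply/seteqP; split => A; rewrite /= /nbhs /=; apply: filterS => z';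
    rewrite /= integrals_average.
have [cf _] := svalP f.
apply: cvgM; first exact: cvg_cst.
apply: cvg_sumr => i _; apply: cvgD.
  apply: (@cvg_comp _ _ _ (fun z' : n.+1.-tuple T * n.+1.-tuple T => tnth z'.1 i)
    (sval f)); last exact: cf.
  by apply/cvgrPdist_lt => e e0; exists e => // z' /(_ i)[h _]; rewrite distrC.
apply: (@cvg_comp _ _ _ (fun z' : n.+1.-tuple T * n.+1.-tuple T => tnth z'.2 i)
    (sval f)); last exact: cf.
by apply/cvgrPdist_lt => e e0; exists e => // z' /(_ i)[_ h]; rewrite distrC.
Qed.

Lemma measurable_average_empirical (G : set (borel_probability R)) : open G ->
  measurable [set z : n.+1.-tuple T * n.+1.-tuple T | G (average_empirical_measure z)].
Proof.
move=> oG; apply: measurable_close_open => z Gz.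
have : nbhs (average_empirical_measure z) G by exact: open_nbhs_nbhs.
by move=> /average_empirical_continuous [r /= r0 sub]; exists r.
Qed.
End empirical_continuity.

(** Repeating m+1 points cyclically gives every residue its limiting frequency
    1/(m+1), so simple and double averages over the first N terms converge to the
    averages over one period. *)
Section periodic_averages.
Context (R : realType) (m : nat).

Definition residue_count (p N : nat) : R := \sum_(i < N) ((i %% m.+1)%N == p)%:R.

(** The indices i < N congruent to p are p, p + (m+1), p + 2(m+1), and so on. *)
Lemma residue_countE p N : (p <= m)%N ->
  residue_count p N = ((N + m - p) %/ m.+1)%N%:R.
Proof.
move=> pm; rewrite /residue_count; elim: N => [|N IH].
  by rewrite big_ord0 divn_small// add0n ltnS leq_subr.
rewrite big_ord_recr /= IH addSn subSn; last by rewrite (leq_trans pm)// leq_addl.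
rewrite divnS// natrD addrC; congr (_%:R + _); congr nat_of_bool.
rewrite -subSn; last by rewrite (leq_trans pm)// leq_addl.
rewrite -addnS -eqn_mod_dvd; last by rewrite (leq_trans pm)// ltnW// leq_addl.
by rewrite modnDr (@modn_small p m.+1).
Qed.

Lemma residue_count_bound p N : (p <= m)%N ->
  `|residue_count p N * m.+1%:R - N%:R| <= m.+1%:R.
Proof.
move=> pm; rewrite residue_countE// -natrM.
have h1 : (((N + m - p) %/ m.+1) * m.+1 <= N + m.+1)%N.
  by apply: (leq_trans (leq_divM _ _)); rewrite addnS ltnW// ltnS leq_subr.
have h2 : (N <= ((N + m - p) %/ m.+1) * m.+1 + m.+1)%N.
  have := divn_eq (N + m - p) m.+1; have := ltn_pmod (N + m - p) (ltn0Sn m).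
  lia.
rewrite ler_norml lerBrDl lerBlDl -!natrD; move: h1 h2.
by rewrite -(ler_nat R) -(ler_nat R N) !natrD; lra.
Qed.

Lemma residue_count_cvg p : (p <= m)%N ->
  residue_count p N.+1 / N.+1%:R @[N --> \oo] --> (m.+1%:R^-1 : R).
Proof.
move=> pm; apply/cvgrPdist_lt => e e0.
apply: filterS (near_infty_natSinv_lt (PosNum e0)) => N /=; apply: le_lt_trans.
have N0 : 0 < N.+1%:R :> R by [].
have m0 : 0 < m.+1%:R :> R by [].
rewrite distrC -(ler_pM2r (mulr_gt0 m0 N0)) -{1}(gtr0_norm (mulr_gt0 m0 N0)) -normrM.
rewrite mulrBl (_ : _ / _ * _ = residue_count p N.+1 * m.+1%:R); last first.
  by field; rewrite gt_eqF.
rewrite mulKf ?gt_eqF// (_ : _^-1 * _ = m.+1%:R); last by field; rewrite gt_eqF.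
exact: residue_count_bound.
Qed.

Lemma sum_residues N (u : nat -> R) :
  \sum_(i < N) u (i %% m.+1)%N = \sum_(p < m.+1) residue_count p N * u p.
Proof.
rewrite /residue_count; under [RHS]eq_bigr do rewrite mulr_suml.
rewrite exchange_big; apply: eq_bigr => i _ /=.
have im : (i %% m.+1 < m.+1)%N by rewrite ltn_mod.
rewrite (bigD1 (Ordinal im)) //= eqxx mul1r big1 ?addr0// => p pi.
rewrite (_ : (_ == _) = false) ?mul0r//; apply/negbTE; apply: contra pi => /eqP h.
by apply/eqP/val_inj.
Qed.

Lemma periodic_average_cvg (u : nat -> R) :
  N.+1%:R^-1 * \sum_(i < N.+1) u (i %% m.+1)%N @[N --> \oo] -->
  m.+1%:R^-1 * \sum_(p < m.+1) u p.
Proof.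
under eq_cvg do rewrite sum_residues mulr_sumr.
rewrite mulr_sumr; apply: cvg_sumr => p _.
under eq_cvg do rewrite mulrA (mulrC _ (residue_count _ _)).
by apply: cvgM; [apply: residue_count_cvg; rewrite -ltnS|exact: cvg_cst].
Qed.

Lemma periodic_average2_cvg (u : nat -> nat -> R) :
  (N.+1%:R ^+ 2)^-1 * \sum_(i < N.+1) \sum_(j < N.+1) u (i %% m.+1)%N (j %% m.+1)%N
    @[N --> \oo] -->
  (m.+1%:R ^+ 2)^-1 * \sum_(p < m.+1) \sum_(q < m.+1) u p q.
Proof.
rewrite (_ : (fun N => _) = (fun N => \sum_(p < m.+1) \sum_(q < m.+1)
   (residue_count p N.+1 / N.+1%:R * (residue_count q N.+1 / N.+1%:R) * u p q))); last first.
  apply/funext => N; under eq_bigr do rewrite (sum_residues _ (u _)).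
  rewrite (sum_residues _ (fun p => \sum_(q < m.+1) residue_count q N.+1 * u p q)).
  rewrite mulr_sumr; apply: eq_bigr => p _; rewrite !mulr_sumr; apply: eq_bigr => q _.
  have : N.+1%:R != 0 :> R by rewrite pnatr_eq0.
  by move=> ?; field.
rewrite expr2 invfM mulr_sumr; apply: cvg_sumr => p _.
rewrite mulr_sumr; apply: cvg_sumr => q _.
apply: cvgM; last exact: cvg_cst.
by apply: cvgM; apply: residue_count_cvg; rewrite -ltnS.
Qed.
End periodic_averages.

(** * The lower bound on Gibbs integrals *)

(** The two factors are the volumes of cubes of side 2/N in R^N, of order
    exp(- N log N): negligible in the scale N^2. *)
Lemma cube_volume_lower (R : realType) (e : R) : 0 < e ->
  \forall N \near \oo, expR (- (N.+1%:R ^+ 2 * e)) <=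
    (2 * N.+1%:R^-1) ^+ N.+1 * (2 * N.+1%:R^-1) ^+ N.+1.
Proof.
move=> e0.
have : \forall N \near \oo, 8 / e ^+ 2 <= N%:R :> R by exact: nbhs_infty_ger.
apply: filterS => N Ne.
have N0 : 0 < N.+1%:R :> R by [].
have NN : 8 / e ^+ 2 <= N.+1%:R :> R by rewrite (le_trans Ne)// ler_nat.
set x := N.+1%:R in N0 NN *.
have base : expR (- (x * (e / 2))) <= 2 * x^-1.
  have h : 1 + x * (e / 4) <= expR (x * (e / 4)) by exact: expR_ge1Dx.
  have y0 : 0 < x * (e / 4) by rewrite mulr_gt0// divr_gt0.
  have h2 : (x * (e / 4)) ^+ 2 <= expR (x * (e / 2)).
    rewrite (_ : x * (e / 2) = 2%:R * (x * (e / 4))); last by field.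
    rewrite expRM_natl lerXn2r ?nnegrE ?expR_ge0//; [exact: ltW|lra].
  rewrite expRN (_ : 2 * x^-1 = (x / 2)^-1); last by rewrite invfM invrK mulrC.
  rewrite lef_pV2 ?posrE ?expR_gt0 ?divr_gt0//.
  apply: le_trans h2; move: NN; rewrite ler_pdivrMr ?exprn_gt0// => NN.
  have : x * 8 <= x * (x * e ^+ 2) by rewrite ler_pM2l.
  rewrite !expr2; lra.
rewrite -exprMn -/x.
have -> : expR (- (x ^+ 2 * e)) = (expR (- (x * (e / 2))) * expR (- (x * (e / 2)))) ^+ N.+1.
  by rewrite -expRD -expRM_natl -/x; congr expR; field.
have b0 : 0 <= 2 * x^-1 by rewrite mulr_ge0// invr_ge0 ltW.
apply: lerXn2r; rewrite ?nnegrE; [|exact: mulr_ge0|].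
  by rewrite mulr_ge0 ?expR_ge0.
by apply: ler_pM => //; exact: expR_ge0.
Qed.

Section lower_bound.
Context (R : realType).
Local Notation T := (measurableTypeR R).
Local Notation Leb n := (lebesgue_tuple R n \x lebesgue_tuple R n)%E.
Variables (k : R * R -> R) (k0 : R).
Hypothesis ck : continuous k.
Hypothesis kk0 : forall u, k0 <= k u.
Hypothesis knd : negative_definite k.

Let repeat m (t : m.+1.-tuple T) (i : nat) : R := nth 0 t (i %% m.+1)%N.

Let in_cubes m (t : m.+1.-tuple T) N (z : N.+1.-tuple T * N.+1.-tuple T) : Prop :=
  cube (repeat t) N.+1%:R^-1 z.1 /\ cube (repeat t) N.+1%:R^-1 z.2.

(** Cubes whose radius shrinks with N make the convergence hold along every
    choice of configurations and for all test functions at once. *)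
Lemma cubes_average_cvg m (t : m.+1.-tuple T)
    (z : forall N, N.+1.-tuple T * N.+1.-tuple T) : (forall N, in_cubes t (z N)) ->
  average_empirical_measure (z N) @[N --> \oo] --> average_empirical_measure (t, t).
Proof.
move=> zt; apply: weak_cvg => f; have [cf _] := svalP f.
rewrite integrals_average sample_mean_diag big_tuple.
rewrite (_ : _ @ _ = (fun N => sample_mean (z N) (sval f)) @ \oo); last first.
  by apply/seteqP; split => A; rewrite /= /nbhs /=; apply: filterS => N;
    rewrite /= integrals_average.
have := @periodic_average_cvg R m (fun p => sval f (nth 0 t p)).
rewrite (eq_bigr (fun p : 'I_m.+1 => sval f (tnth t p))) => [av|p _]; last by rewrite (tnth_nth 0).
apply/cvgrPdist_lt => e e0; have e20 : 0 < e / 2 by rewrite divr_gt0.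
have /cvgrPdist_lt /(_ _ e20) av2 := av.
have near_f : \forall N \near \oo, forall p : 'I_m.+1, forall y : R,
    `|y - tnth t p| < N.+1%:R^-1 -> `|sval f y - sval f (tnth t p)| < e / 2.
  apply: filter_forall => p.
  have /cvgrPdist_lt /(_ _ e20) /nbhs_ballP[r /= r0 sub] := cf (tnth t p).
  apply: filterS (near_infty_natSinv_lt (PosNum r0)) => N /= Nr y yt.
  by rewrite distrC; apply: sub; rewrite /ball /= distrC; exact: lt_trans Nr.
apply: filterS2 av2 near_f => N {}av2 near_f.
have repeatE i : repeat t i = tnth t (Ordinal (ltn_pmod i (ltn0Sn m))).
  by rewrite (tnth_nth 0).
have [z1 z2] := zt N.
suff h : `|sample_mean (z N) (sval f) -
    N.+1%:R^-1 * \sum_(i < N.+1) sval f (nth 0 t (i %% m.+1)%N)| <= e / 2.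
  rewrite (splitr e); apply: le_lt_trans (ler_distD _ _ _) _.
  by apply: ltr_leD av2 _; rewrite distrC.
have N0 : 0 < (2 * N.+1)%:R :> R by [].
have -> : sample_mean (z N) (sval f) -
    N.+1%:R^-1 * \sum_(i < N.+1) sval f (nth 0 t (i %% m.+1)%N) =
    (2 * N.+1)%:R^-1 * \sum_(i < N.+1)
      ((sval f (tnth (z N).1 i) - sval f (repeat t i)) +
       (sval f (tnth (z N).2 i) - sval f (repeat t i))).
  rewrite /sample_mean; under [in RHS]eq_bigr => i _.
    rewrite (_ : _ + _ = (sval f (tnth (z N).1 i) + sval f (tnth (z N).2 i)) -
      2 * sval f (repeat t i)); last by ring.
    over.
  rewrite sumrB -mulr_sumr natrM.
  have : N.+1%:R != 0 :> R by rewrite pnatr_eq0.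
  by move=> ?; field.
rewrite normrM gtr0_norm ?invr_gt0// ler_pdivrMl//.
apply: (le_trans (ler_norm_sum _ _ _)).
have -> : (2 * N.+1)%:R * (e / 2) = \sum_(i < N.+1) (e / 2 + e / 2).
  by rewrite sumr_const card_ord -mulr_natl natrM; ring.
apply: ler_sum => i _; apply: (le_trans (ler_normD _ _)).
by rewrite repeatE; apply: lerD; apply: ltW; apply: near_f; rewrite -repeatE;
  [exact: z1|exact: z2].
Qed.

(** Convergence along all choices is made uniform by choosing in each cube a
    configuration that leaves G as soon as some configuration does. *)
Lemma cubes_open m (t : m.+1.-tuple T) (G : set (borel_probability R)) :
  open G -> G (average_empirical_measure (t, t)) ->
  \forall N \near \oo, forall z : N.+1.-tuple T * N.+1.-tuple T,
    in_cubes t z -> G (average_empirical_measure z).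
Proof.
move=> oG Gt.
pose inside N := forall z : N.+1.-tuple T * N.+1.-tuple T,
  in_cubes t z -> G (average_empirical_measure z).
have wit N : exists z : N.+1.-tuple T * N.+1.-tuple T,
    in_cubes t z /\ (G (average_empirical_measure z) -> inside N).
  have [H|] := pselect (inside N).
    pose c : N.+1.-tuple T := [tuple repeat t i | i < N.+1].
    exists (c, c); split; last by move=> _ z' z't; apply: H.
    by split=> i; rewrite tnth_mktuple subrr normr0 invr_gt0.
  by move=> /existsNP[z /not_implyP[zt nG]]; exists z; split.
pose z N := projT1 (cid (wit N)).
have zP N := projT2 (cid (wit N)).
have Gz : \forall N \near \oo, G (average_empirical_measure (z N)).
  have zt N : in_cubes t (z N) by exact: (proj1 (zP N)).
  exact: (cubes_average_cvg zt (open_nbhs_nbhs (conj oG Gt))).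
by apply: filterS Gz => N GN; exact: (proj2 (zP N)) GN.
Qed.

(** The integral is restricted to the cubes around the cyclic repetition of a
    sample given by [energy_approximation], taken as centre for both species. The
    error e is shared by the approximation of the energy of nu, the periodic
    average, the oscillation of k on the cubes, and the volume. *)
Lemma boltzmann_lower_eventually (nu : borel_probability R) (G : set (borel_probability R)) e :
  open G -> G nu -> (energy k nu < +oo)%E -> 0 < e ->
  \forall N \near \oo,
   ((expR (- (N.+1%:R ^+ 2 * (fine (energy k nu) + e))))%:E <=
    \int[Leb N.+1]_(z in [set z | G (average_empirical_measure z)]) boltzmann k z)%E.
Proof.
move=> oG Gnu knu e0; set E := fine _.
have e40 : 0 < e / 4 by rewrite divr_gt0.
have [m [t [Gt tE]]] := energy_approximation ck kk0 knd oG Gnu knu e40.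
have near_k : \forall N \near \oo, forall u : 'I_m.+1 * 'I_m.+1, forall y y' : R,
    `|y - tnth t u.1| < N.+1%:R^-1 -> `|y' - tnth t u.2| < N.+1%:R^-1 ->
    k (y, y') <= k (tnth t u.1, tnth t u.2) + e / 4.
  apply: filter_forall => -[p q] /=.
  have /cvgrPdist_lt /(_ _ e40) /nbhs_ballP[r /= r0 sub] := @ck (tnth t p, tnth t q).
  apply: filterS (near_infty_natSinv_lt (PosNum r0)) => N /= Nr y y' yt yt'.
  have := sub (y, y'); rewrite ltr_norml => h.
  suff : - (e / 4) < k (tnth t p, tnth t q) - k (y, y') < e / 4 by lra.
  by apply: h; split; rewrite /ball /= distrC; [exact: lt_trans yt Nr|exact: lt_trans yt' Nr].
have sum_k : \forall N \near \oo,
    \sum_(i < N.+1) \sum_(j < N.+1) k (repeat t i, repeat t j) <=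
      N.+1%:R ^+ 2 * (E + e / 4 + e / 4).
  have := @periodic_average2_cvg R m (fun p q => k (nth 0 t p, nth 0 t q)).
  rewrite (_ : \sum_(p < m.+1) _ = interaction k (t, t)); last first.
    by apply: eq_bigr => p _; apply: eq_bigr => q _; rewrite !(tnth_nth 0).
  move=> /cvgrPdist_lt /(_ _ e40); apply: filterS => N.
  have N0 : 0 < N.+1%:R ^+ 2 :> R by rewrite exprn_gt0.
  have m0 : 0 < m.+1%:R ^+ 2 :> R by rewrite exprn_gt0.
  rewrite -ler_pdivrMl// /repeat /= => h.
  have : (m.+1%:R ^+ 2)^-1 * interaction k (t, t) <= E + e / 4 by rewrite ler_pdivrMl.
  have aux (a b c d : R) : `|a - b| < d -> a <= c -> b <= c + d.
    by rewrite ltr_norml; lra.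
  exact: aux h.
apply: filterS3 (cubes_open oG Gt) (filterI near_k sum_k) (cube_volume_lower e40).
move=> N GN [{}near_k {}sum_k] vol.
pose B := N.+1%:R ^+ 2 * (E + e / 4 + e / 4 + e / 4).
have N0 : 0 < N.+1%:R^-1 :> R by rewrite invr_gt0.
have mG := @measurable_average_empirical R N G oG.
have repeatE i : repeat t i = tnth t (Ordinal (ltn_pmod i (ltn0Sn m))).
  by rewrite (tnth_nth 0).
apply: le_trans (@boltzmann_lower R k N.+1 _ B (repeat t) _ ck mG N0 _).
  rewrite lee_fin (_ : - (_ * _) = - B + - (N.+1%:R ^+ 2 * (e / 4))); last by rewrite /B; field.
  by rewrite expRD ler_wpM2l ?expR_ge0.
move=> z z1 z2; split; first exact: GN.
apply: (@le_trans _ _ (\sum_(i < N.+1) \sum_(j < N.+1) (k (repeat t i, repeat t j) + e / 4))).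
  apply: ler_sum => i _; apply: ler_sum => j _; rewrite !repeatE.
  by apply: (near_k (_, _)); rewrite /= -repeatE; [exact: z1|exact: z2].
under eq_bigr do rewrite big_split sumr_const card_ord -mulr_natl /=.
rewrite big_split sumr_const card_ord -mulr_natl /= /B; lra.
Qed.
End lower_bound.

(** * Asymptotics of Gibbs probabilities in the scale n^2 *)

Section gibbs_asymptotics.
Context (R : realType).
Local Notation T := (measurableTypeR R).
Local Notation Leb n := (lebesgue_tuple R n \x lebesgue_tuple R n)%E.
Variables (k : R * R -> R) (k0 : R).
Hypothesis ck : continuous k.
Hypothesis kk0 : forall u, k0 <= k u.
Hypothesis knd : negative_definite k.
Hypothesis k0_diag : forall e : R, 0 < e -> exists x, k (x, x) < k0 + e.
Hypothesis k_int : forall e : R, 0 < e -> e <= 1 ->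
  (\int[@lebesgue_measure R \x @lebesgue_measure R]_u (expR (- (e * k u)))%:E < +oo)%E.

Let Zbar n : \bar R := (\int[Leb n.+1]_z boltzmann k z)%E.
Let Z n : R := fine (Zbar n).

Let exp_moment e : 0 < e -> e <= 1 -> exists c : R, forall n,
  ((\int[@lebesgue_measure R \x @lebesgue_measure R]_u (expR (- (e * k u)))%:E) ^+ n
   <= (expR (n%:R * c))%:E)%E.
Proof.
move=> e0 e1; have := k_int e0 e1.
set I := (\int[_]_u _)%E => Ioo.
have I0 : (0 <= I)%E by apply: integral_ge0 => u _; rewrite lee_fin expR_ge0.
have Ifin : I \is a fin_num by rewrite ge0_fin_numE.
exists (ln (fine I + 1)) => n.
rewrite expRM_natl lnK ?posrE ?ltr_wpDl ?fine_ge0// EFin_expe.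
rewrite -[X in (X ^+ _)%E](fineK Ifin) -!EFin_expe lee_fin.
by rewrite lerXn2r ?nnegrE ?addr_ge0 ?fine_ge0// lerDl.
Qed.

(** The reference level k0 is separated from the excess j, which alone is
    weakened by the factor 1 - e. *)
Let boltzmann_upper_exp e : 0 < e -> e <= 1 -> exists c : R, forall n A j,
  measurable A ->
  (forall z, A z -> n.+1%:R ^+ 2 * (j + k0) <= interaction k z) ->
  (\int[Leb n.+1]_(z in A) boltzmann k z <=
   (expR (- (n.+1%:R ^+ 2 * (k0 + (1 - e) * j)) + n.+1%:R * c))%:E)%E.
Proof.
move=> e0 e1; have [c hc] := exp_moment e0 e1.
exists (c + e * k0) => n A j mA jS.
have e01 : 0 <= e <= 1 by rewrite ltW.
apply: (le_trans (boltzmann_upper ck kk0 mA e01 jS)).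
apply: (@le_trans _ _ ((expR (- ((1 - e) * (n.+1%:R ^+ 2 * (j + k0)) +
    e * ((n.+1%:R ^+ 2 - n.+1%:R) * k0))))%:E * (expR (n.+1%:R * c))%:E)%E).
  by rewrite lee_wpmul2l// lee_fin expR_ge0.
by rewrite -EFinM -expRD lee_fin ler_expR; lra.
Qed.

(** Positivity comes from a cube around the origin on which k is at most
    k (0, 0) + 1. *)
Lemma boltzmann_total n : (0 < Zbar n < +oo)%E.
Proof.
apply/andP; split; last first.
  have [c hc] := @boltzmann_upper_exp 1 ltr01 (lexx 1).
  apply: le_lt_trans (hc n setT 0 measurableT _) _; last exact: ltry.
  by move=> z _; rewrite add0r; exact: (interaction_ge_min z kk0).
have /cvgrPdist_lt /(_ 1 ltr01) /nbhs_ballP[r /= r0 sub] := @ck (0, 0).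
apply: (lt_le_trans _ (@boltzmann_lower R k n.+1 setT (n.+1%:R ^+ 2 * (k (0, 0) + 1))
    (fun=> 0) r ck measurableT r0 _)).
  by rewrite lte_fin mulr_gt0 ?expR_gt0// mulr_gt0// exprn_gt0// mulr_gt0.
  move=> z z1 z2; split=> //.
  rewrite /interaction.
  have -> : n.+1%:R ^+ 2 * (k (0, 0) + 1) = \sum_(i < n.+1) \sum_(j < n.+1) (k (0, 0) + 1).
    by rewrite !sumr_const card_ord -mulrnA -[RHS]mulr_natl natrM expr2.
  apply: ler_sum => i _; apply: ler_sum => j _.
  have := sub (tnth z.1 i, tnth z.2 j); rewrite ltr_norml => h.
  suff : -1 < k (0, 0) - k (tnth z.1 i, tnth z.2 j) < 1 by lra.
  by apply: h; split; rewrite /ball /= distrC; [exact: z1|exact: z2].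
Qed.

Let ZE n : Zbar n = (Z n)%:E.
Proof.
have /andP[Z0 Zoo] := boltzmann_total n.
by rewrite /Z fineK// ge0_fin_numE// ltW.
Qed.

Let Z_gt0 n : 0 < Z n.
Proof. by have /andP[+ _] := boltzmann_total n; rewrite ZE lte_fin. Qed.

Let Z_upper : exists c : R, forall n, Z n <= expR (- (n.+1%:R ^+ 2 * k0) + n.+1%:R * c).
Proof.
have [c hc] := @boltzmann_upper_exp 1 ltr01 (lexx 1); exists c => n.
have := hc n setT 0 measurableT; rewrite -/(Zbar n) ZE lee_fin mulr0 addr0.
by apply => z _; rewrite add0r; exact: (interaction_ge_min z kk0).
Qed.

(** The lower bound over all configurations, at a point mass almost minimizing k
    on the diagonal; this point mass is the empirical measure of one point. *)
Let Z_lower e : 0 < e ->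
  \forall n \near \oo, expR (- (n.+1%:R ^+ 2 * (k0 + e))) <= Z n.
Proof.
move=> e0; have e20 : 0 < e / 2 by rewrite divr_gt0.
have [x kx] := k0_diag e20.
pose t : 1.-tuple T := [tuple x].
pose nu := average_empirical_measure (t, t).
have nuE : energy k nu = (k (x, x))%:E.
  rewrite energy_average//; congr (_%:E).
  rewrite !sample_mean_diag !big_seq1 invr1 !mul1r sample_mean_diag big_seq1.
  by rewrite invr1 mul1r.
have := @boltzmann_lower_eventually R k k0 ck kk0 knd nu setT _ openT I _ e20.
rewrite nuE => /(_ (ltry _)); apply: filterS => n h.
rewrite -lee_fin -ZE; apply: le_trans h; rewrite lee_fin ler_expR lerN2 /=.
by apply: ler_wpM2l; [exact: sqr_ge0|lra].
Qed.

Definition gibbs_probability n (A : set (n.+1.-tuple T * n.+1.-tuple T)) : \bar R :=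
  ((\int[Leb n.+1]_(z in A) boltzmann k z) * (Z n)^-1%:E)%E.

Let scaled_lne_le n (p : \bar R) (X : R) : (0 <= p)%E -> (p <= (expR X)%:E)%E ->
  (((n.+1%:R ^+ 2)^-1)%:E * lne p <= (X / n.+1%:R ^+ 2)%:E)%E.
Proof.
move=> p0 pX; rewrite [X in (_ <= X%:E)%E]mulrC EFinM.
rewrite lee_wpmul2l// ?lee_fin ?invr_ge0 ?sqr_ge0//.
rewrite -[X in (_ <= X%:E)%E]expRK -lne_EFin ?expR_gt0//.
by rewrite lee_lne// in_itv/= ?p0 leey// lee_fin expR_ge0.
Qed.

Let scaled_lne_ge n (p : \bar R) (X : R) : ((expR X)%:E <= p)%E ->
  ((X / n.+1%:R ^+ 2)%:E <= ((n.+1%:R ^+ 2)^-1)%:E * lne p)%E.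
Proof.
move=> pX; have p0 : (0 <= p)%E by apply: le_trans pX; rewrite lee_fin expR_ge0.
rewrite [X in (X%:E <= _)%E]mulrC EFinM.
rewrite lee_wpmul2l// ?lee_fin ?invr_ge0 ?sqr_ge0//.
rewrite -[X in (X%:E <= _)%E]expRK -lne_EFin ?expR_gt0//.
by rewrite lee_lne// in_itv/= ?p0 leey// lee_fin expR_ge0.
Qed.

Let small_over e (c : R) : 0 < e -> \forall n \near \oo, n.+1%:R * c <= n.+1%:R ^+ 2 * e.
Proof.
move=> e0; have : \forall n \near \oo, c / e <= n%:R :> R by exact: nbhs_infty_ger.
apply: filterS => n; rewrite ler_pdivrMr// => h.
rewrite expr2 -mulrA ler_pM2l //; apply: (le_trans h); rewrite ler_pM2r // ler_nat.
exact: leqnSn.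
Qed.

(** By [energy_average_le] a configuration whose empirical measure lies in F has
    interaction at least n^2 (j + k0), so the bound is pointwise up to the factor
    1 - e and terms of order n. *)
Lemma gibbs_upper_bound (F : set (borel_probability R)) (j : R) : 0 <= j ->
  (forall n, measurable
     [set z : n.+1.-tuple T * n.+1.-tuple T | F (average_empirical_measure z)]) ->
  (forall nu, F nu -> ((j + k0)%:E <= energy k nu)%E) ->
  (limn_esup (fun n => ((n.+1%:R ^+ 2)^-1)%:E * lne (@gibbs_probability n
     [set z | F (average_empirical_measure z)])) <= (- j)%:E)%E.
Proof.
move=> j0 mF Fj; apply/lee_addgt0Pr => d d0.
(* The total loss is e (j + 2): e j from the factor 1 - e, e from the partition
   function and e from the terms linear in n. *)
pose e := Num.min 1 (d / (j + 2)).
have j2 : 0 < j + 2 by lra.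
have e0 : 0 < e by rewrite lt_min ltr01 divr_gt0.
have e1 : e <= 1 by rewrite ge_min lexx.
have ed : e * (j + 2) <= d by rewrite -ler_pdivlMr// ge_min lexx orbT.
have [c hc] := boltzmann_upper_exp e0 e1.
apply: limn_esup_le; apply: filterS2 (Z_lower e0) (small_over c e0) => n Zn cn.
have N0 : 0 < n.+1%:R ^+ 2 :> R by rewrite exprn_gt0.
apply: (@le_trans _ _ ((- (n.+1%:R ^+ 2 * (j - e * (j + 2)))) / n.+1%:R ^+ 2)%:E); last first.
  rewrite -EFinD lee_fin mulNr mulrAC divff ?mul1r ?gt_eqF//; lra.
have iF0 A : (0 <= \int[Leb n.+1]_(z in A) boltzmann k z)%E.
  by apply: integral_ge0 => z _; rewrite lee_fin expR_ge0.
apply: scaled_lne_le.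
  by rewrite mule_ge0// lee_fin invr_ge0 ltW.
rewrite /gibbs_probability lee_pdivrMr// -EFinM.
apply: (le_trans (hc n _ j (mF n) _)) => [z Fz|].
  have := le_trans (Fj _ Fz) (energy_average_le z ck knd).
  by rewrite lee_fin ler_pdivlMr// mulrC.
rewrite lee_fin; apply: le_trans (ler_wpM2l (expR_ge0 _) Zn).
rewrite -expRD ler_expR; lra.
Qed.

Lemma gibbs_lower_bound (G : set (borel_probability R)) nu : open G -> G nu ->
  (- (energy k nu - k0%:E) <=
   limn_einf (fun n => ((n.+1%:R ^+ 2)^-1)%:E * lne (@gibbs_probability n
     [set z | G (average_empirical_measure z)])))%E.
Proof.
move=> oG Gnu; have [knu|] := ltP (energy k nu) +oo%E; last first.
  by rewrite leye_eq => /eqP ->; rewrite addye// leNye.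
have EE : energy k nu = (fine (energy k nu))%:E.
  rewrite fineK// fin_numElt knu andbT.
  exact: lt_le_trans (ltNyr k0) (energy_ge ck kk0 nu).
rewrite EE -EFinB -EFinN; apply/lee_subgt0Pr => d d0.
have d20 : 0 < d / 2 by rewrite divr_gt0.
have [c hc] := Z_upper.
apply: limn_einf_ge.
have lowG := boltzmann_lower_eventually ck kk0 knd oG Gnu knu d20.
apply: filterS2 lowG (small_over c d20) => n Gn cn.
set E := fine _ in Gn *.
have N0 : 0 < n.+1%:R ^+ 2 :> R by rewrite exprn_gt0.
apply: (@le_trans _ _ ((- (n.+1%:R ^+ 2 * (E - k0 + d))) / n.+1%:R ^+ 2)%:E).
  rewrite -EFinB lee_fin mulNr mulrAC divff ?mul1r ?gt_eqF//; lra.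
apply: scaled_lne_ge; rewrite /gibbs_probability lee_pdivlMr// -EFinM.
apply: le_trans Gn; rewrite lee_fin.
apply: (le_trans (ler_wpM2l (expR_ge0 _) (hc n))).
rewrite -expRD ler_expR; lra.
Qed.
End gibbs_asymptotics.

Unset Implicit Arguments.

(** * The large deviation principle *)

Theorem corollary1 (R : realType) (g k : R * R -> R)
  (g_continuous : continuous g)
  (g_ge0 : forall x y : R, 0 <= g (x, y))
  (g_integrable : forall alpha : R, 0 < alpha -> alpha <= 1 ->
    (\int[@lebesgue_measure R \x @lebesgue_measure R]_z
       (g z `^ alpha)%:E < +oo)%E)
  (g_bounded : exists C : R, forall x y : R, g (x, y) <= expR C)
  (g_compact : forall a : R, 0 < a -> compact [set z | expR (- a) <= g z])
  (g_diagonal : exists beta : R, 0 <= beta /\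
    exists h : R * R -> R, continuous h /\
      forall x y : R, x <> y ->
        (h (x, y))%:E = ((beta * ln `|x - y|)%:E - lne (g (x, y))%:E)%E)
  (k_log : forall x y : R, (k (x, y))%:E = (- lne (g (x, y))%:E)%E)
  (k_continuous : continuous k)
  (k_negative_definite : negative_definite k) :
  let I0 : \bar R := ereal_inf (range (fun z : R * R => (k z)%:E)) in
  [/\ forall n : nat, (0 < partition_function g n.+1 < +oo)%E,
      forall Pr : forall n : nat,
          probability (n.+1.-tuple (measurableTypeR R) *
                       n.+1.-tuple (measurableTypeR R))%type R,
        (forall n A, measurable A -> Pr n A = gibbs g A) ->
        large_deviation_principle Pr (fun n z => average_empirical_measure z)
          (fun n : nat => n.+1%:R ^+ 2)
          (fun nu : borel_probability R => energy k nu - I0)%E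
    & I0 = ereal_inf (range (fun x : R => (k (x, x))%:E))].
Proof.
have gE u : g u = expR (- k u).
  case: u => x y; have := k_log x y.
  have [g0|g0] := leP (g (x, y)) 0; first by rewrite le0_lneNy ?lee_fin.
  by rewrite lne_EFin// -EFinN => -[->]; rewrite opprK lnK ?posrE.
set I0 := ereal_inf _ => /=.
have [C gC] := g_bounded.
have kC u : - C <= k u.
  by case: u => x y; have := gC x y; rewrite gE ler_expR; lra.
have I0_le u : (I0 <= (k u)%:E)%E by apply: ereal_inf_lbound; exists u.
have I0E : (fine I0)%:E = I0.
  rewrite fineK// fin_numElt (le_lt_trans (I0_le (0, 0))) ?ltry// andbT.
  apply: (@lt_le_trans _ _ (- C)%:E); first exact: ltNyr.
  by apply: le_ereal_inf_tmp => _ [u _ <-]; rewrite lee_fin.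
pose k0 := fine I0.
have kk0 u : k0 <= k u by rewrite -lee_fin I0E.
have diag : I0 = ereal_inf (range (fun x : R => (k (x, x))%:E)).
  apply/eqP; rewrite eq_le; apply/andP; split.
    by apply: le_ereal_inf_tmp => _ [x _ <-]; exact: I0_le.
  apply: le_ereal_inf_tmp => _ [[x y] _ <-].
  have hx : (ereal_inf (range (fun x : R => (k (x, x))%:E)) <= (k (x, x))%:E)%E.
    by apply: ereal_inf_lbound; exists x.
  have hy : (ereal_inf (range (fun x : R => (k (x, x))%:E)) <= (k (y, y))%:E)%E.
    by apply: ereal_inf_lbound; exists y.
  have := negdef2 k_negative_definite x y.
  have [xy|yx] := leP (k (x, x)) (k (y, y)) => h.
    by apply: (le_trans hx); rewrite lee_fin; lra.
  by apply: (le_trans hy); rewrite lee_fin; lra.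
have k0_diag (e : R) : 0 < e -> exists x, k (x, x) < k0 + e.
  move=> e0; have : (ereal_inf (range (fun x : R => (k (x, x))%:E)) < (k0 + e)%:E)%E.
    by rewrite -diag -I0E lte_fin ltrDl.
  by move=> /ereal_inf_lt[_ [x _ <-]]; rewrite lte_fin; exists x.
have k_int (e : R) : 0 < e -> e <= 1 ->
    (\int[@lebesgue_measure R \x @lebesgue_measure R]_u (expR (- (e * k u)))%:E < +oo)%E.
  move=> e0 e1; have := g_integrable e e0 e1; congr (_ < _)%E.
  by apply: eq_integral => u _; rewrite gE -expRM mulNr mulrC.
have ZE n : partition_function g n.+1 =
    (\int[lebesgue_tuple R n.+1 \x lebesgue_tuple R n.+1]_z boltzmann k z)%E.
  by apply: eq_integral => z _; rewrite /boltzmann (gibbs_weight_expR z gE).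
have Zb n : (0 < partition_function g n.+1 < +oo)%E.
  by rewrite ZE; exact: (boltzmann_total k_continuous kk0 k_int).
split=> [//|Pr PrE|//].
have mG n (G : set (borel_probability R)) : open G ->
    measurable [set z : n.+1.-tuple (measurableTypeR R) * n.+1.-tuple (measurableTypeR R) |
      G (average_empirical_measure z)].
  exact: measurable_average_empirical.
have mF n (F : set (borel_probability R)) : closed F ->
    measurable [set z : n.+1.-tuple (measurableTypeR R) * n.+1.-tuple (measurableTypeR R) |
      F (average_empirical_measure z)].
  by move=> /closed_openC /(mG n) /measurableC; rewrite setCK.
have PrE' n A : measurable A -> Pr n A = gibbs_probability k A.
  move=> mA; rewrite PrE// /gibbs /gibbs_probability -ZE.
  have mB := measurable_funTS (@measurable_boltzmann R k n.+1 k_continuous).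
  rewrite -ge0_integralZr//; last 2 first.
  - by move=> z _; rewrite lee_fin expR_ge0.
  - by rewrite lee_fin invr_ge0 fine_ge0// ltW//; have /andP[] := Zb n.
  by apply: eq_integral => z _; rewrite EFinM /boltzmann (gibbs_weight_expR z gE).
split.
- by move=> n G /(mG n).
- split.
    by move=> nu; rewrite -I0E sube_ge0// (energy_ge k_continuous kk0).
  move=> nu a; rewrite -I0E -/k0 lteBrDr// -EFinD => /(energy_lsc k_continuous kk0)[V nV HV].
  exists V => // y /HV h; by rewrite lteBrDr.
- move=> F cF.
  rewrite [X in (limn_esup X <= _)%E](_ : _ = (fun n => ((n.+1%:R ^+ 2)^-1)%:E *
    lne (gibbs_probability k
      [set z : n.+1.-tuple (measurableTypeR R) * n.+1.-tuple (measurableTypeR R) |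
        F (average_empirical_measure z)]))%E); last first.
    by apply/funext => n; rewrite PrE'//; exact: mF.
  set J := ereal_inf _.
  have J0 : (0 <= J)%E.
    by apply: le_ereal_inf_tmp => _ [nu _ <-]; rewrite -I0E sube_ge0// (energy_ge k_continuous kk0).
  have key (j : R) : 0 <= j -> (j%:E <= J)%E ->
      (limn_esup (fun n => ((n.+1%:R ^+ 2)^-1)%:E * lne (gibbs_probability k
        [set z : n.+1.-tuple (measurableTypeR R) * n.+1.-tuple (measurableTypeR R) |
          F (average_empirical_measure z)])) <= (- j)%:E)%E.
    move=> j0 jJ.
    apply: (gibbs_upper_bound k_continuous kk0 k_negative_definite k0_diag k_int) => //.
      by move=> n; exact: mF.
    move=> nu Fnu; rewrite EFinD -leeBrDr// I0E (le_trans jJ)//.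
    by apply: ereal_inf_lbound; exists nu.
  (* When the infimum is infinite every finite level j is available. *)
  case: J J0 key => [j| |] //.
    by rewrite lee_fin => j0 /(_ j j0 (lexx _)).
  move=> _ key; rewrite /= leeNy_eq; apply/eqP/eq_ninfty => M.
  apply: (le_trans (key `|M| (normr_ge0 _) (leey _))).
  by rewrite lee_fin lerNl -normrN ler_norm.
- move=> G oG.
  rewrite [X in (_ <= limn_einf X)%E](_ : _ = (fun n => ((n.+1%:R ^+ 2)^-1)%:E *
    lne (gibbs_probability k
      [set z : n.+1.-tuple (measurableTypeR R) * n.+1.-tuple (measurableTypeR R) |
        G (average_empirical_measure z)]))%E); last first.
    by apply/funext => n; rewrite PrE'//; exact: mG.
  rewrite leeNl; apply: le_ereal_inf_tmp => _ [nu Gnu <-].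
  rewrite leeNl -I0E; exact: gibbs_lower_bound.
Qed.
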